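(* Let $n\ge 1$, let $n_1,\dots,n_r$ ($r\ge 1$) be positive integers with $m:=n_1+\dots+n_r\le n$, and put $d_\ell=\sum_{s=1}^{\ell}n_s$, so that $d_r=m$. Let $$\mathcal{O}^{\mathrm{SO}(2n)}_{n_1,\dots,n_r}:=\frac{\mathrm{SO}(2n)}{\mathrm{U}(n_1)\times\cdots\times \mathrm{U}(n_r)\times \mathrm{SO}(2n-2m)},$$ and consider the product manifold $$\mathcal{N}^{\mathrm{SO}(2n)}=\mathsf{OGr}_{d_1}\times \mathsf{OGr}_{d_2}\times\cdots\times\mathsf{OGr}_{m}\times\mathsf{OGr}_{m}$$ ($r+1$ factors: $\mathsf{OGr}_{d_1},\dots,\mathsf{OGr}_{d_r}$, followed by one more $\mathsf{OGr}_m$), endowed with a product symplectic form, where the $\ell$-th factor ($\ell=1,\dots,r+1$) is the adjoint orbit of $\Lambda_\ell:=\Upsilon_\ell\otimes\mathcal{J}_2$ with its Kirillov–Kostant–Souriau form. Here $$\Upsilon_\ell=2^{r-\ell}\,\mathrm{Diag}\bigl(-\mathds{1}_{n_1},\dots,-\mathds{1}_{n_{\ell-1}},\mathds{1}_{n_\ell},\mathbf{0}_{n_{\ell+1}},\dots,\mathbf{0}_{n_r},\mathbf{0}_{n-m}\bigr),\qquad \ell=1,\dots,r,$$ $$\Upsilon_{r+1}=\mathrm{Diag}\bigl(-\mathds{1}_{n_1},\dots,-\mathds{1}_{n_r},\mathbf{0}_{n-m}\bigr).$$ Then there is an isotropic embedding $$\mathcal{O}^{\mathrm{SO}(2n)}_{n_1,\dots,n_r}\hookrightarrow\mathcal{N}^{\mathrm{SO}(2n)}$$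 whose image is $\mu^{-1}(0)$, where $\mu$ is the moment map for the diagonal action of $\mathrm{SO}(2n)$ on $\mathcal{N}^{\mathrm{SO}(2n)}$. The embedding is given by $$(x_1,\dots,x_r)\mapsto\bigl(x_1,\;x_1^\ast\oplus x_2,\;\dots,\;x_1^\ast\oplus\cdots\oplus x_{r-1}^\ast\oplus x_r,\;x_1^\ast\oplus\cdots\oplus x_{r-1}^\ast\oplus x_r^\ast\bigr).$$
   Context: $\mathsf{OGr}_k:=\mathrm{SO}(2n)/(\mathrm{SO}(2n-2k)\times\mathrm{U}(k))$, with $\mathrm{SO}(0)$ the trivial group. $\mathcal{J}_2=\begin{pmatrix}0&1\\-1&0\end{pmatrix}$; $\mathds{1}_k$ and $\mathbf{0}_k$ are the $k\times k$ identity and zero matrices; $\Upsilon\otimes\mathcal{J}_2$ is the block-diagonal matrix with $2\times2$ blocks $\Upsilon_{ii}\mathcal{J}_2$. A subspace of $\mathbb{C}^{2n}$ is isotropic if the form $u^tv$ vanishes on it; orthogonality of subspaces is with respect to $u^\dagger v$; $y^\ast$ is the complex conjugate of the subspace $y$. The adjoint orbit of $\Lambda_\ell$, $\{g\Lambda_\ell g^t: g\in\mathrm{SO}(2n)\}$, is identified with a space of isotropic planes (of dimension $d_\ell$ for $\ell\le r$, of dimension $m$ for $\ell=r+1$) by sending $g\Lambda_\ell g^t$ to the positive-eigenvalue eigenspace of the Hermitian matrix $i\,g\Lambda_\ell g^t$. (When the plane has dimension $n$ this is one of the two $\mathrm{SO}(2n)$-orbits of isotropic $n$-planes.) Points of $\mathcal{O}^{\mathrm{SO}(2n)}_{n_1,\dots,n_r}$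 are $r$-tuples $(x_1,\dots,x_r)$ of mutually orthogonal subspaces with $\dim x_j=n_j$ and $x_1\oplus\dots\oplus x_r$ isotropic. (If $m=n$, one takes the $\mathrm{SO}(2n)$-orbit of the base tuple, in which $x_j$ is the positive eigenspace of $i\mathcal{J}_2$ on the $j$-th diagonal block of size $2n_j$.) The Kirillov–Kostant–Souriau form on an adjoint orbit is $\omega_x(\xi,\zeta)=\langle x,[\xi,\zeta]\rangle$, with $\langle X,Y\rangle=\mathrm{Tr}(XY)$ and tangent vectors at $x$ represented by the Lie algebra elements generating them. The moment map is, up to the identification of $\mathfrak{so}_{2n}$ with its dual and the factor $i$, $\mu=i\sum_{\ell=1}^{r+1}g_\ell\Lambda_\ell g_\ell^t$ at the point $(g_\ell\Lambda_\ell g_\ell^t)_{\ell=1}^{r+1}$, $g_\ell\in\mathrm{SO}(2n)$. An embedding is isotropic if the symplectic form restricts to zero on the image. *)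

(* Defs.v *)
From HB Require Import structures.
From mathcomp Require Import all_boot all_order all_algebra.
From mathcomp Require Import complex mxtens.
From mathcomp Require Import all_classical all_reals all_analysis.

Set Implicit Arguments.
Unset Strict Implicit.
Unset Printing Implicit Defensive.

Import Order.TTheory GRing.Theory Num.Theory.
Import numFieldNormedType.Exports.

Local Open Scope classical_set_scope.
Local Open Scope ring_scope.
Local Open Scope complex_scope.

(** ** Subspaces of C^N, as [{vspace 'cV[R[i]]_N}] *)

Definition cplx_mx (R : realType) (p q : nat) (A : 'M[R]_(p, q)) :
  'M[R[i]]_(p, q) := map_mx (real_complex R) A.

Definition image_sub (R : realType) (N : nat) (g : 'M[R]_N)
    (x : {vspace 'cV[R[i]]_N}) : {vspace 'cV[R[i]]_N} :=
  (linfun (mulmx (cplx_mx g)) @: x)%VS.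

(* Conjugation is only semilinear, so x^* is the span of a conjugated basis. *)
Definition conj_sub (R : realType) (N : nat) (x : {vspace 'cV[R[i]]_N}) :
    {vspace 'cV[R[i]]_N} :=
  <<[seq map_mx conjc v | v <- vbasis x]>>%VS.

Definition isotropic_sub (R : realType) (N : nat)
    (x : {vspace 'cV[R[i]]_N}) : Prop :=
  forall u v : 'cV[R[i]]_N, u \in x -> v \in x -> u^T *m v = 0.

Definition orthogonal_sub (R : realType) (N : nat)
    (x y : {vspace 'cV[R[i]]_N}) : Prop :=
  forall u v : 'cV[R[i]]_N, u \in x -> v \in y -> (map_mx conjc u)^T *m v = 0.

(* The sum of the eigenspaces of H for the positive roots of its
   characteristic polynomial; in R[i], [0 < a] means that a is real and
   positive. *)
Definition pos_eigenspace (R : realType) (N : nat) (H : 'M[R[i]]_N) :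
    {vspace 'cV[R[i]]_N} :=
  (\sum_(a <- sval (closed_field_poly_normal (char_poly H)) | (0 < a)%R)
     passmx.leigenspace (linfun (mulmx H)) a)%VS.

Definition pos_plane (R : realType) (N : nat) (A : 'M[R]_N) :
    {vspace 'cV[R[i]]_N} :=
  pos_eigenspace ('i%C *: cplx_mx A).

(** ** SO(N), its Lie algebra, and adjoint orbits *)

Definition SO (R : realType) (N : nat) : set 'M[R]_N :=
  [set g | g^T *m g = 1%:M /\ \det g = 1].
Arguments SO : clear implicits.

Definition so (R : realType) (N : nat) : set 'M[R]_N :=
  [set X | X^T = - X].
Arguments so : clear implicits.

Definition lie_bracket (R : realType) (N : nat) (X Y : 'M[R]_N) : 'M[R]_N :=
  X *m Y - Y *m X.

Definition adjoint_orbit (R : realType) (N : nat) (L : 'M[R]_N) :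
    set 'M[R]_N :=
  [set A | exists2 g, SO R N g & A = g *m L *m g^T].

(* X and Y represent the tangent vectors [X, A] and [Y, A] of the orbit. *)
Definition KKS (R : realType) (N : nat) (A X Y : 'M[R]_N) : R :=
  \tr (A *m lie_bracket X Y).

(* Tangent vectors of an SO(N)-space at x are the velocities at t = 0 of
   t |-> c t . x; the class of c is determined by its velocity X in so(N). *)
Definition SO_curve (R : realType) (N : nat) (c : R -> 'M[R]_N)
    (X : 'M[R]_N) : Prop :=
  [/\ forall t, SO R N (c t), c 0 = 1%:M & is_derive (0 : R) (1 : R) c X].

(** ** Smooth maps *)

Fixpoint Ck_on (R : realType) (V W : normedModType R) (k : nat) (U : set V)
    (f : V -> W) : Prop :=
  match k with
  | 0 => forall x, U x -> {for x, continuous f}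
  | k'.+1 => (forall x, U x -> differentiable f x) /\
             (forall v : V, Ck_on k' U (fun x => 'D_v f x))
  end.

(* Smoothness on an embedded submanifold S of V: local smooth extensions. *)
Definition smooth_on (R : realType) (V W : normedModType R) (S : set V)
    (f : V -> W) : Prop :=
  forall x, S x -> exists (U : set V) (h : V -> W),
    [/\ open U, U x, forall k, Ck_on k U h
      & forall y, S y -> U y -> f y = h y].

(** ** The flag manifold O_{n_1,...,n_r}

    The block sizes are [ns : 'I_r -> nat]; block indices are 0-based. *)

Definition psum (r : nat) (ns : 'I_r -> nat) (l : nat) : nat :=
  (\sum_(j < r | (j < l)%N) ns j)%N.

Definition J2 (R : realType) : 'M[R]_2 :=
  \matrix_(i, j) (if (i < j)%N then 1 else if (j < i)%N then -1 else 0).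
Arguments J2 : clear implicits.

(* J_2 on each of the 2 x 2 diagonal blocks number i with
   psum j <= i < psum j.+1, zero elsewhere. *)
Definition block_J (R : realType) (n r : nat) (ns : 'I_r -> nat) (j : 'I_r) :
    'M[R]_(n * 2) :=
  diag_mx (\row_(i < n) (psum ns j <= i < psum ns j.+1)%N%:R) *t J2 R.
Arguments block_J R n {r} ns j.

Definition flag (R : realType) (n r : nat) : Type :=
  'I_r -> {vspace 'cV[R[i]]_(n * 2)}.
Arguments flag : clear implicits.

Definition flag_act (R : realType) (n r : nat) (g : 'M[R]_(n * 2))
    (x : flag R n r) : flag R n r :=
  fun j => image_sub g (x j).

Definition base_flag (R : realType) (n r : nat) (ns : 'I_r -> nat) :
    flag R n r :=
  fun j => pos_plane (block_J R n ns j).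
Arguments base_flag R n {r} ns.

Definition flag_manifold (R : realType) (n r : nat) (ns : 'I_r -> nat) :
    set (flag R n r) :=
  [set x |
    [/\ forall j, \dim (x j) = ns j,
        forall j k, j != k -> orthogonal_sub (x j) (x k),
        isotropic_sub (\sum_(j < r) x j)%VS
      & psum ns r = n ->
        exists2 g, SO R (n * 2) g & x = flag_act g (base_flag R n ns)]].
Arguments flag_manifold R n {r} ns.

(* The quotient topology of SO(2n)/(U(n_1) x ... x U(n_r) x SO(2n-2m)),
   whose denominator is the stabiliser of [base_flag]; its points are
   identified with those of [flag_manifold] by the orbit map. *)
Definition flag_open (R : realType) (n r : nat) (ns : 'I_r -> nat)
    (U : set (flag R n r)) : Prop :=
  exists2 V : set 'M[R]_(n * 2), open V
    & forall g, SO R (n * 2) g -> (U (flag_act g (base_flag R n ns)) <-> V g).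

(** ** The product N of adjoint orbits *)

(* With blocks and factors counted from 1, [Upsilon R n ns l] is
   Upsilon_{l+1}; the last one, Upsilon_{r+1}, is the case l = r. *)
Definition Upsilon (R : realType) (n r : nat) (ns : 'I_r -> nat) (l : nat) :
    'M[R]_n :=
  if (l < r)%N then
    2 ^+ (r - l.+1) *: diag_mx (\row_(i < n)
      (if (i < psum ns l)%N then -1 else if (i < psum ns l.+1)%N then 1 else 0))
  else diag_mx (\row_(i < n) (if (i < psum ns r)%N then -1 else 0)).
Arguments Upsilon R n {r} ns l.

Definition Lambda (R : realType) (n r : nat) (ns : 'I_r -> nat) (l : nat) :
    'M[R]_(n * 2) :=
  Upsilon R n ns l *t J2 R.
Arguments Lambda R n {r} ns l.

Definition orbit_product (R : realType) (n r : nat) (ns : 'I_r -> nat) :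
    set ('I_r.+1 -> 'M[R]_(n * 2)) :=
  [set a | forall l : 'I_r.+1, adjoint_orbit (Lambda R n ns l) (a l)].
Arguments orbit_product R n {r} ns.

Definition product_form (R : realType) (n r : nat)
    (a X Y : 'I_r.+1 -> 'M[R]_(n * 2)) : R :=
  \sum_(l < r.+1) KKS (a l) (X l) (Y l).

Definition moment_map (R : realType) (n r : nat)
    (a : 'I_r.+1 -> 'M[R]_(n * 2)) : 'M[R[i]]_(n * 2) :=
  'i%C *: cplx_mx (\sum_(l < r.+1) a l).

(** ** Maps from the flag manifold to N *)

(* With factors counted from 0, the l-th component is
   x_0^* + ... + x_{l-1}^* + x_l; at the last index l = r the second sum is
   empty. *)
Definition embedding_plane (R : realType) (n r : nat) (x : flag R n r)
    (l : nat) : {vspace 'cV[R[i]]_(n * 2)} :=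
  (\sum_(j < r | (j < l)%N) conj_sub (x j) +
   \sum_(j < r | (j : nat) == l) x j)%VS.

(* A map out of a homogeneous space is smooth iff its composite with the orbit
   map is smooth on the group. *)
Definition flag_smooth (R : realType) (n r : nat) (ns : 'I_r -> nat)
    (F : flag R n r -> 'I_r.+1 -> 'M[R]_(n * 2)) : Prop :=
  forall l : 'I_r.+1,
    smooth_on (SO R (n * 2)) (fun g => F (flag_act g (base_flag R n ns)) l).

Definition is_pushforward (R : realType) (n r : nat)
    (F : flag R n r -> 'I_r.+1 -> 'M[R]_(n * 2)) (x : flag R n r)
    (c : R -> 'M[R]_(n * 2)) (v : 'I_r.+1 -> 'M[R]_(n * 2)) : Prop :=
  forall l : 'I_r.+1,
    is_derive (0 : R) (1 : R) (fun t => F (flag_act (c t) x) l) (v l).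

(* X in so(2n) generates the zero tangent vector at x iff it lies in the Lie
   algebra of the stabiliser of x, i.e. iff X maps each x_j into itself. *)
Definition flag_immersion (R : realType) (n r : nat) (ns : 'I_r -> nat)
    (F : flag R n r -> 'I_r.+1 -> 'M[R]_(n * 2)) : Prop :=
  forall x, flag_manifold R n ns x -> forall c X, SO_curve c X ->
    is_pushforward F x c (fun=> 0) ->
    forall j, (image_sub X (x j) <= x j)%VS.

(* The topology of the flag manifold is induced by F from the product
   topology. *)
Definition flag_inducing (R : realType) (n r : nat) (ns : 'I_r -> nat)
    (F : flag R n r -> 'I_r.+1 -> 'M[R]_(n * 2)) : Prop :=
  forall U, U `<=` flag_manifold R n ns ->
    (flag_open ns U <->
     exists2 W : set (prod_topology (fun=> 'M[R]_(n * 2))), open W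
       & U = flag_manifold R n ns `&` F @^-1` W).

Definition flag_embedding (R : realType) (n r : nat) (ns : 'I_r -> nat)
    (F : flag R n r -> 'I_r.+1 -> 'M[R]_(n * 2)) : Prop :=
  [/\ forall x y, flag_manifold R n ns x -> flag_manifold R n ns y ->
        F x = F y -> x = y,
      flag_smooth ns F, flag_immersion ns F & flag_inducing ns F].

(* The pullback by F of the product form vanishes; for each l, [X l] and [Y l]
   generate the l-th components of the images under dF of two tangent vectors
   at x. *)
Definition flag_isotropic (R : realType) (n r : nat) (ns : 'I_r -> nat)
    (F : flag R n r -> 'I_r.+1 -> 'M[R]_(n * 2)) : Prop :=
  forall x, flag_manifold R n ns x ->
  forall c d X0 Y0, SO_curve c X0 -> SO_curve d Y0 ->
  forall X Y : 'I_r.+1 -> 'M[R]_(n * 2),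
    (forall l, so R (n * 2) (X l)) -> (forall l, so R (n * 2) (Y l)) ->
    is_pushforward F x c (fun l => lie_bracket (X l) (F x l)) ->
    is_pushforward F x d (fun l => lie_bracket (Y l) (F x l)) ->
    product_form (F x) X Y = 0.

(* Main.v *)
From HB Require Import structures.
From mathcomp Require Import all_boot all_order all_algebra perm.
From mathcomp Require Import complex mxtens.
From mathcomp Require Import all_classical all_reals all_analysis.
From mathcomp Require Import ring lra zify.
Require Import Defs.

Set Implicit Arguments.
Unset Strict Implicit.
Unset Printing Implicit Defensive.

Import Order.TTheory GRing.Theory Num.Theory.
Import numFieldNormedType.Exports.

Local Open Scope classical_set_scope.
Local Open Scope ring_scope.
Local Open Scope complex_scope.

(** The idea is to replace every isotropic plane by a real matrix. An isotropic
    plane [x], with orthogonal projector [P], is the eigenspace for the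
    eigenvalue 1 of [i K], where [i K = P - P^*]; here [K] is a real
    skew-symmetric matrix with [K^3 = - K], called a partial complex structure
    below. In this language a point of the flag manifold is a family of such
    matrices [K j] that annihilate each other, and the plane
    [x_0^* + ... + x_(l-1)^* + x_l] has the structure
    [K l - \sum_(j < l) K j]. The embedding [flag_map] sends the family to these
    differences, rescaled by the weights of the [Lambda l]. It is equivariant
    and sends the base flag to the point [(Lambda l)_l].

    Each weight is the sum of all the later ones, so the components of
    [flag_map x] add up to zero ([sum_component]): the image lies in the zero
    level of the moment map. Isotropy follows, since by equivariance the
    pullback of the product form at [x] pairs the moment map with a Lie bracket.

    Conversely, let [a] be a point of the zero level. The first matrix [a 0]
    has norm [wt 0], and minus it is the sum of the others, whose norms [wt k]
    also add up to [wt 0]. Equality in the triangle inequality forces all the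
    other [a k] to act on the range of [a 0] as multiples of [a 0]
    ([saturation]). Splitting off this range leaves a similar situation with
    one matrix less, and by induction [a] comes from a family [K j] of
    mutually annihilating partial complex structures ([chain_decomposition]).
    Such a family is determined up to orthogonal conjugacy by its ranks
    ([simultaneous_conj]): unit vectors [p] and [q] in corresponding ranges
    can be matched together with their images under the structures, and one
    proceeds on the orthogonal complement. With [m] the sum of the block
    sizes, a reflection takes care of the determinant if [m < n]; if [m = n]
    it is prescribed, because a real matrix commuting with a complex structure
    has nonnegative determinant ([det_commuting_cx_ge0]). This is [SO_conj],
    which also shows that SO(2n) acts transitively on the flag manifold.

    The remaining points are soft. The family [K j] is obtained from the
    components by solving a triangular system ([component_eq0]), which gives
    injectivity and, after differentiation, immersivity. Smoothness holds
    because [g *m L *m g^T] is quadratic in [g], and the topologies agree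
    because SO(2n) is compact. *)

(** * Traces and partial complex structures *)

Lemma trmxZ (R : pzRingType) m n a (A : 'M[R]_(m, n)) : (a *: A)^T = a *: A^T.
Proof. by apply/matrixP => i j; rewrite !mxE. Qed.

Lemma trmxD (R : pzRingType) m n (A B : 'M[R]_(m, n)) : (A + B)^T = A^T + B^T.
Proof. by apply/matrixP => i j; rewrite !mxE. Qed.

Lemma trmxN (R : pzRingType) m n (A : 'M[R]_(m, n)) : (- A)^T = - A^T.
Proof. by apply/matrixP => i j; rewrite !mxE. Qed.

Lemma mxtraceN (R : pzRingType) n (A : 'M[R]_n) : \tr (- A) = - \tr A.
Proof. exact: raddfN. Qed.

Lemma tr_gram_ge0 (R : realDomainType) m n (A : 'M[R]_(m, n)) :
  0 <= \tr (A^T *m A).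
Proof.
rewrite /mxtrace; apply: sumr_ge0 => i _; rewrite mxE.
by apply: sumr_ge0 => j _; rewrite mxE -expr2 sqr_ge0.
Qed.

Lemma tr_gram_eq0 (R : realDomainType) m n (A : 'M[R]_(m, n)) :
  (\tr (A^T *m A) == 0) = (A == 0).
Proof.
apply/idP/eqP => [|->]; last by rewrite mulmx0 mxtrace0.
have pos j : 0 <= (A^T *m A) j j.
  by rewrite mxE; apply: sumr_ge0 => k _; rewrite mxE -expr2 sqr_ge0.
rewrite /mxtrace psumr_eq0 => [|j _]; last exact: pos.
move=> /allP h; apply/matrixP => i j; rewrite [RHS]mxE.
have := h j (mem_index_enum j); rewrite /= mxE psumr_eq0 => [|k _]; last first.
  by rewrite mxE -expr2 sqr_ge0.
by move=> /allP /(_ i (mem_index_enum i)); rewrite /= mxE -expr2 sqrf_eq0 => /eqP.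
Qed.

Lemma sym_idem_tr_eq0 (R : realDomainType) N (Q : 'M[R]_N) :
  Q^T = Q -> Q *m Q = Q -> (\tr Q == 0) = (Q == 0).
Proof. by move=> Qs Qi; rewrite -tr_gram_eq0 Qs Qi. Qed.

Lemma sym_idem_unit_vector (R : rcfType) N (Q : 'M[R]_N) :
  Q *m Q = Q -> Q != 0 -> exists p : 'cV[R]_N, p^T *m p = 1%:M /\ Q *m p = p.
Proof.
move=> Qi Q0.
have [j vj0] : exists j, col j Q != 0.
  apply/existsP; apply: contraNT Q0; rewrite negb_exists => /forallP h.
  apply/eqP/matrixP => i j; have := h j; rewrite negbK => /eqP/matrixP/(_ i 0).
  by rewrite !mxE.
pose v := col j Q; pose s := \tr (v^T *m v).
have s0 : 0 < s by rewrite lt_def tr_gram_ge0 tr_gram_eq0 vj0.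
have Qv : Q *m v = v by rewrite /v colE mulmxA Qi.
exists ((Num.sqrt s)^-1 *: v); split; last by rewrite -scalemxAr Qv.
rewrite trmxZ -scalemxAl -scalemxAr scalerA -invfM -expr2.
rewrite sqr_sqrtr ?ltW// [_ *m _]mx11_scalar -trace_mx11 -/s.
by rewrite scale_scalar_mx mulVf ?gt_eqF.
Qed.

(** A complex structure on its range, extended by zero to the orthogonal
    complement. With [K] real skew-symmetric, [K^3 = - K] says that the
    eigenvalues of [i K] are among [1], [-1] and [0], so that isotropic planes
    (the eigenspaces for [1]) and partial complex structures determine each
    other. *)
Definition partial_cx (R : pzRingType) N (K : 'M[R]_N) :=
  K^T = - K /\ K *m K *m K = - K.

(** * Equality in the triangle inequality *)

(** Each [b k] has operator norm at most [c k], while on the range of [K],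
    where [K] is an isometry, the sum of the [- b k] has norm [\sum_k c k]:
    every [- b k] must then act there as [c k *: K].  In terms of traces, the
    squared Frobenius norm of [b k *m K^2 - c k *: K], divided by [c k], is at
    most [-2 c k tr (K^2) - 2 tr (K *m b k)], and these bounds add up to
    zero. *)
Lemma saturation (R : realFieldType) N (I : finType) (P : pred I)
    (K : 'M[R]_N) (b : I -> 'M[R]_N) (c : I -> R) :
  partial_cx K ->
  (forall k, P k -> [/\ 0 < c k, (b k)^T = - b k
                      & b k *m b k *m b k = - (c k ^+ 2 *: b k)]) ->
  \sum_(k | P k) b k = - ((\sum_(k | P k) c k) *: K) ->
  forall k, P k -> b k *m (K *m K) = c k *: K.
Proof.
move=> [Ks K3] bP sumb.
pose D k := b k *m (K *m K) - c k *: K.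
have bound k : P k -> \tr ((D k)^T *m D k) / c k <=
    - 2 * c k * \tr (K *m K) - 2 * \tr (K *m b k).
  move=> Pk; have [c0 bs b3] := bP k Pk.
  rewrite ler_pdivrMr //; move: c0 bs b3; rewrite /D.
  move: (b k) (c k) => B d d0 Bs B3 {bP sumb D Pk k b c}.
  have DE : \tr ((B *m (K *m K) - d *: K)^T *m (B *m (K *m K) - d *: K)) =
      \tr (B *m B *m (K *m K)) - 2 * d * \tr (K *m B) - d ^+ 2 * \tr (K *m K).
    rewrite trmxD trmxN trmxZ !trmx_mul Ks Bs !(mulNmx, mulmxN, opprK).
    rewrite scalerN opprK mulmxDl !mulmxDr -!scalemxAl !mulmxN -!scalemxAr.
    rewrite ?scalerN ?mulNmx ?opprK ?scalerA -?expr2.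
    rewrite !mxtraceD !mxtraceN !mxtraceZ.
    have -> : \tr (K *m K *m B *m (B *m (K *m K))) = - \tr (B *m B *m (K *m K)).
      rewrite !mulmxA mxtrace_mulC !mulmxA K3 !mulNmx mxtraceN; congr (- _).
      by rewrite -!mulmxA mxtrace_mulC !mulmxA.
    have -> : \tr (- (K *m K *m B *m K)) = \tr (K *m B).
      by rewrite mxtraceN mxtrace_mulC !mulmxA K3 mulNmx mxtraceN opprK.
    have -> : \tr (K *m (B *m (K *m K))) = - \tr (K *m B).
      by rewrite mulmxA mxtrace_mulC !mulmxA K3 mulNmx mxtraceN.
    ring.
  have := tr_gram_ge0 ((d ^+ 2)%:M *m K + B *m B *m K).
  have -> : \tr (((d ^+ 2)%:M *m K + B *m B *m K)^T *m
                 ((d ^+ 2)%:M *m K + B *m B *m K)) =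
            - d ^+ 2 * (d ^+ 2 * \tr (K *m K) + \tr (B *m B *m (K *m K))).
    rewrite -mulmxDl trmx_mul trmxD tr_scalar_mx trmx_mul Bs Ks.
    rewrite !(mulNmx, mulmxN) opprK !mulmxA -(mulmxA K).
    have -> : ((d ^+ 2)%:M + B *m B) *m ((d ^+ 2)%:M + B *m B) =
              d ^+ 2 *: ((d ^+ 2)%:M + B *m B).
      rewrite mulmxDl !mulmxDr !mul_scalar_mx mul_mx_scalar mulmxA B3 mulNmx.
      by rewrite -scalemxAl subrr addr0 scalerDr.
    rewrite mxtraceN -scalemxAr -scalemxAl mxtraceZ mxtrace_mulC mulmxA mulmxDr.
    by rewrite mxtraceD mul_mx_scalar mxtraceZ mulNr
      [\tr (K *m K *m _)]mxtrace_mulC !mulmxA.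
  rewrite DE => h.
  have {}h : d ^+ 2 * \tr (K *m K) + \tr (B *m B *m (K *m K)) <= 0.
    by rewrite -(pmulr_rle0 _ (exprn_gt0 2 d0)); move: h; rewrite mulNr oppr_ge0.
  nra.
have nng k : P k -> 0 <= \tr ((D k)^T *m D k) / c k.
  move=> Pk; have [c0 _ _] := bP k Pk.
  by rewrite divr_ge0 ?tr_gram_ge0 // ltW.
have : \sum_(k | P k) \tr ((D k)^T *m D k) / c k == 0.
  rewrite eq_le sumr_ge0 // andbT; apply: le_trans (ler_sum _ bound) _.
  rewrite sumrB -!mulr_suml -!mulr_sumr -(linear_sum (@mxtrace _ _)) /=.
  rewrite -mulmx_sumr sumb mulmxN -scalemxAr mxtraceN mxtraceZ.
  by rewrite le_eqVlt; apply/orP; left; apply/eqP; ring.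
rewrite psumr_eq0 // => /allP h k Pk.
have := h k (mem_index_enum k); rewrite Pk /=.
have [c0 _ _] := bP k Pk.
rewrite mulf_eq0 invr_eq0 (gt_eqF c0) orbF tr_gram_eq0 subr_eq0.
by move/eqP.
Qed.

Lemma partial_cx_mul0 (R : comPzRingType) N (A B : 'M[R]_N) :
  A^T = - A -> B^T = - B -> A *m B = 0 -> B *m A = 0.
Proof.
move=> As Bs /(congr1 trmx).
by rewrite trmx_mul As Bs mulNmx mulmxN opprK trmx0.
Qed.

Lemma partial_cxD (R : comPzRingType) N (A B : 'M[R]_N) :
  partial_cx A -> partial_cx B -> A *m B = 0 -> partial_cx (A + B).
Proof.
move=> [As A3] [Bs B3] AB; have BA := partial_cx_mul0 As Bs AB.
split; first by rewrite trmxD As Bs opprD.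
have -> : (A + B) *m (A + B) = A *m A + B *m B.
  by rewrite mulmxDl !mulmxDr AB BA addr0 add0r.
by rewrite mulmxDl !mulmxDr A3 B3 -!mulmxA AB BA !mulmx0 addr0 add0r opprD.
Qed.

(** The hypothesis on [a *m (S *m S)] says that [a] agrees with [- c *: S] on
    the range of [S], which it therefore preserves; what remains is supported
    on the orthogonal complement of that range. *)
Lemma split_part (R : comPzRingType) N (S a : 'M[R]_N) (c : R) :
  partial_cx S -> a^T = - a -> a *m a *m a = - (c ^+ 2 *: a) ->
  a *m (S *m S) = c *: S ->
  let b := a + c *: S in
  [/\ b^T = - b, b *m b *m b = - (c ^+ 2 *: b) & b *m S = 0].
Proof.
move=> [Ss S3] As a3 aSS b.
have SSa : S *m S *m a = c *: S.
  have := congr1 trmx aSS.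
  by rewrite !trmx_mul trmxZ Ss As !(mulNmx, mulmxN) !opprK scalerN => /oppr_inj.
have aS : a *m S = - (c *: (S *m S)).
  by rewrite -[S in LHS]opprK -S3 mulmxN !mulmxA -(mulmxA a) aSS -scalemxAl.
have Sa : S *m a = - (c *: (S *m S)).
  by rewrite -[S in LHS]opprK -S3 mulNmx -!mulmxA (mulmxA S S a) SSa -scalemxAr.
split.
- by rewrite trmxD trmxZ As Ss scalerN opprD.
- have -> : b *m b = a *m a - c ^+ 2 *: (S *m S).
    rewrite /b mulmxDl !mulmxDr -!scalemxAl -!scalemxAr aS Sa.
    rewrite !scalerN !scalerA -expr2 -addrA.
    by rewrite addNr addr0.
  rewrite mulmxBl !mulmxDr a3 -!scalemxAl -!scalemxAr SSa S3.
  rewrite -mulmxA aS mulmxN -scalemxAr aSS !scalerN !scalerA.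
  rewrite scalerDr scalerA opprD.
  have -> : c * c * c = c ^+ 2 * c by ring.
  by rewrite subrr addr0 opprD.
- by rewrite /b mulmxDl aS -scalemxAl addNr.
Qed.

(** The scalar factors of the matrices [Upsilon]. The exceptional value at
    [l = r] makes each weight the sum of all the later ones, which is what forces
    the extremal situation of [saturation]. *)
Definition wt (R : pzRingType) (r l : nat) : R :=
  if (l < r)%N then 2 ^+ (r - l.+1) else 1.
Arguments wt R : clear implicits.

Lemma wt_gt0 (R : numDomainType) r l : 0 < wt R r l.
Proof. by rewrite /wt; case: ifP => _ //; rewrite exprn_gt0. Qed.

Lemma sum_wt (R : comPzRingType) r l : (l <= r)%N ->
  \sum_(k < r.+1 | (l <= k)%N) wt R r k = 2 ^+ (r - l).
Proof.
move=> lr; rewrite -(big_geq_mkord _ _ predT (wt R r)).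
have [d ->] : exists d, l = (r - d)%N by exists (r - l)%N; rewrite subKn.
elim: d {l lr} => [|d IH].
  by rewrite subn0 big_nat1 /wt ltnn subnn.
have [dr|rd] := ltnP d r; last first.
  have -> : (r - d.+1)%N = (r - d)%N by lia.
  exact: IH.
rewrite big_ltn; last lia.
have -> : (r - d.+1).+1 = (r - d)%N by lia.
rewrite IH /wt ifT; last lia.
have -> : (r - (r - d.+1).+1 = d)%N by lia.
have -> : (r - (r - d) = d)%N by lia.
have -> : (r - (r - d.+1) = d.+1)%N by lia.
by rewrite exprS /=  mulr2n mulrDl !mul1r.
Qed.

(** If [a k = wt k *: (K k - \sum_(j < k) K j)] for all [k < r], then the sum
    of the first [l] terms telescopes to [2^(r-l)] times
    [\sum_(j < l) K j]. Hence this formula reads off the partial sums of the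
    unknown family [K] from [a]. *)
Definition scaled_psum (R : unitRingType) N (a : nat -> 'M[R]_N) r l :=
  (2 ^+ (r - l))^-1 *: \sum_(k < l) a k.

Lemma scaled_psumS (R : numFieldType) N (a : nat -> 'M[R]_N) r l :
  (l < r)%N ->
  scaled_psum a r l.+1 - scaled_psum a r l =
    (wt R r l)^-1 *: (a l + wt R r l *: scaled_psum a r l).
Proof.
move=> lr; rewrite /scaled_psum big_ord_recr /= /wt lr.
have -> : (r - l = (r - l.+1).+1)%N by lia.
set e := (r - l.+1)%N; set T := \sum_(k < l) _.
have n0 : (2 : R) ^+ e != 0 by rewrite expf_neq0 // pnatr_eq0.
have n20 : (2 : R) != 0 by rewrite pnatr_eq0.
rewrite exprS !scalerDr !scalerA addrAC -scalerBl addrC; congr (_ + _ *: _).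
by field.
Qed.

(** By induction on [l]. Once [S l] is split off, the remaining parts
    [a k + wt k *: S l], for [l <= k], sum to zero, and the first of them
    balances all the others with its full norm, because [wt l] is the sum of
    the later weights; [saturation] then makes the later ones act as required
    on its range. *)
Lemma extremal_chain (R : realFieldType) N r (a : nat -> 'M[R]_N) :
  (forall k, (k <= r)%N ->
     (a k)^T = - a k /\ a k *m a k *m a k = - (wt R r k ^+ 2 *: a k)) ->
  \sum_(k < r.+1) a k = 0 ->
  let S := scaled_psum a r in
  forall l, (l <= r)%N ->
    [/\ partial_cx (S l),
      forall k, (l <= k <= r)%N -> a k *m (S l *m S l) = wt R r k *: S l
    & (l < r)%N -> partial_cx (S l.+1 - S l) /\ (S l.+1 - S l) *m S l = 0].
Proof.
move=> ha suma S.
have tail l : (l <= r)%N ->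
    \sum_(k < r.+1 | (l <= k)%N) (a k + wt R r k *: S l) = 0.
  move=> lr; rewrite big_split /= -scaler_suml sum_wt // /S /scaled_psum.
  rewrite scalerA divff ?expf_neq0 ?pnatr_eq0 // scale1r.
  rewrite (big_ord_widen r.+1 a (leqW lr)) addrC.
  rewrite -[RHS]suma [in RHS](bigID (fun k : 'I_r.+1 => (k < l)%N)) /=.
  by congr (_ + _); apply: eq_bigl => k; rewrite -leqNgt.
have step l : (l < r)%N -> partial_cx (S l) ->
    (forall k, (l <= k <= r)%N -> a k *m (S l *m S l) = wt R r k *: S l) ->
    partial_cx (S l.+1 - S l) /\ (S l.+1 - S l) *m S l = 0.
  move=> lr Sl aS; have [al a3] := ha l (ltnW lr).
  have [|bs b3 bS] := split_part Sl al a3; first by rewrite aS // leqnn ltnW.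
  have w0 := wt_gt0 R r l.
  rewrite scaled_psumS //; split; last by rewrite -scalemxAl bS scaler0.
  split; first by rewrite trmxZ bs scalerN.
  rewrite -!scalemxAl -!scalemxAr -!scalemxAl b3 !scalerN !scalerA.
  by congr (- (_ *: _)); field; rewrite gt_eqF.
suff H l : (l <= r)%N -> partial_cx (S l) /\
    forall k, (l <= k <= r)%N -> a k *m (S l *m S l) = wt R r k *: S l.
  move=> l lr; have [h1 h2] := H l lr; split => // ltlr; exact: step.
elim: l => [_|l IH lr].
  rewrite /S /scaled_psum big_ord0 scaler0; split.
    by split; rewrite ?trmx0 ?mul0mx oppr0.
  by move=> k _; rewrite !mulmx0 scaler0.
have [Sl aS] := IH (ltnW lr); have [Kcx KS] := step l lr Sl aS.
have [K KE] : exists K, K = S l.+1 - S l by exists (S l.+1 - S l).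
rewrite -KE in Kcx KS.
have SK : S l *m K = 0 by apply: partial_cx_mul0 KS; [case: Kcx | case: Sl].
have -> : S l.+1 = S l + K by rewrite KE addrC subrK.
split; first exact: partial_cxD.
pose b k := a k + wt R r k *: S l.
have bK k : (l < k <= r)%N -> b k *m (K *m K) = wt R r k *: K.
  move=> /andP[lk kr].
  have hb (i : 'I_r.+1) : (l < i)%N -> [/\ 0 < wt R r i, (b i)^T = - b i
      & b i *m b i *m b i = - (wt R r i ^+ 2 *: b i)].
    move=> li; have [al a3] := ha i (ltn_ord i).
    have [|bs b3 _] := split_part Sl al a3.
      by apply: aS; rewrite (ltnW li) -ltnS ltn_ord.
    by split => //; exact: wt_gt0.
  apply: (saturation (c := fun i : 'I_r.+1 => wt R r i) Kcx hb _
    (k := Ordinal (kr : (k < r.+1)%N)) lk).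
  have := tail l (ltnW lr).
  rewrite (bigD1 (Ordinal (leqW lr : (l < r.+1)%N))) //= -/(b l).
  have -> : b l = wt R r l *: K.
    by rewrite KE scaled_psumS // scalerA divff ?scale1r // gt_eqF // wt_gt0.
  have lE (i : 'I_r.+1) : (l <= i)%N && (i != Ordinal (leqW lr : (l < r.+1)%N)) =
      (l < i)%N by rewrite -val_eqE /= ltn_neqAle eq_sym andbC.
  rewrite (eq_bigl _ _ lE) addrC => /eqP; rewrite addr_eq0 => /eqP ->.
  by rewrite sum_wt // /wt lr.
move=> k lk; have /andP[lk' kr] := lk.
rewrite !mulmxDl !mulmxDr KS SK !mulmx0 addr0 add0r.
rewrite aS ?(ltnW lk') // scalerDr; congr (_ + _).
by rewrite -bK // /b mulmxDl -scalemxAl (mulmxA (S l)) SK mul0mx scaler0 addr0.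
Qed.

(** With [K j] the partial complex structure of the plane [x_j], the plane
    [x_0^* + ... + x_(l-1)^* + x_l] has the partial complex structure
    [K l - \sum_(j < l) K j], and this is its rescaling into the adjoint orbit
    of [Lambda l]. For [l = r] the first sum is empty. *)
Definition component (R : pzRingType) N r (K : 'I_r -> 'M[R]_N) (l : nat) : 'M[R]_N :=
  wt R r l *: (\sum_(j < r | (j : nat) == l) K j - \sum_(j < r | (j < l)%N) K j).

(** This is what the equation [moment_map a = 0] amounts to: each [K l] is the
    increment of the partial sums produced by [extremal_chain]. The traces,
    which will identify the ranks, follow because
    [S l.+1 = S l + K l] and [a l = wt l *: (K l - S l)] have, up to the
    weight, the same square. *)
Lemma chain_decomposition (R : realFieldType) N r (a : nat -> 'M[R]_N)
    (t : 'I_r -> R) :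
  (forall k, (k <= r)%N ->
     (a k)^T = - a k /\ a k *m a k *m a k = - (wt R r k ^+ 2 *: a k)) ->
  \sum_(k < r.+1) a k = 0 ->
  (forall k : 'I_r,
     \tr (a k *m a k) = wt R r k ^+ 2 * \sum_(j < r | (j <= k)%N) t j) ->
  exists K : 'I_r -> 'M[R]_N,
    [/\ forall j, partial_cx (K j), forall i j, i != j -> K i *m K j = 0,
        forall j, \tr (K j *m K j) = t j
      & forall l, (l <= r)%N -> a l = component K l].
Proof.
move=> ha suma tra.
have := extremal_chain ha suma; set S : nat -> 'M[R]_N := scaled_psum a r => /= chain.
pose K (j : 'I_r) : 'M[R]_N := S j.+1 - S j.
have S0 : S 0%N = 0 by rewrite /S /scaled_psum big_ord0 scaler0.
have SE l : (l <= r)%N -> \sum_(j < r | (j < l)%N) K j = S l.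
  move=> lr; rewrite -(big_ord_widen _ (fun j => S j.+1 - S j) lr).
  by rewrite -(big_mkord predT (fun j => S j.+1 - S j)) telescope_sumr // S0 subr0.
have K_S (j : 'I_r) : K j *m S j = 0.
  by have [_ _ /(_ (ltn_ord j)) []] := chain j (ltnW (ltn_ord j)).
have Kcx (j : 'I_r) : partial_cx (K j).
  by have [_ _ /(_ (ltn_ord j)) []] := chain j (ltnW (ltn_ord j)).
have Scx l : (l <= r)%N -> partial_cx (S l) by move=> /chain[].
have S_K (j : 'I_r) : S j *m K j = 0.
  apply: partial_cx_mul0 (K_S j); first by have [] := Kcx j.
  by have [] := Scx j (ltnW (ltn_ord j)).
have SSub (l : 'I_r) : S l.+1 = S l + K l by rewrite /K addrC subrK.
have aE (l : 'I_r) : a l = wt R r l *: (K l - S l).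
  have w0 := wt_gt0 R r l.
  rewrite /K /S (scaled_psumS a (ltn_ord l)) scalerBr scalerA divff ?gt_eqF //.
  by rewrite scale1r addrK.
(* The range of S j is contained in that of S l for j <= l, so K l kills it. *)
have SSj l j : (j <= l)%N -> (l <= r)%N -> S l *m S j = S j *m S j.
  elim: l => [|l IH]; first by rewrite leqn0 => /eqP ->.
  rewrite leq_eqVlt => /orP[/eqP -> //|jl] lr.
  have {}jl : (j <= l)%N := jl; have [_ S3] := Scx j (leq_trans jl (ltnW lr)).
  have /= KS0 := K_S (Ordinal lr).
  have KSj : K (Ordinal lr) *m S j = 0.
    rewrite -[S j]opprK -S3 mulmxN -(IH jl (ltnW lr)) !mulmxA KS0.
    by rewrite !mul0mx oppr0.
  by rewrite (SSub (Ordinal lr)) mulmxDl KSj addr0 IH // ltnW.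
have KSj (l : 'I_r) j : (j <= l)%N -> K l *m S j = 0.
  move=> jl; rewrite /K mulmxBl !SSj ?subrr ?(leqW jl) //.
  exact: ltnW (ltn_ord l).
have KK (l j : 'I_r) : (j < l)%N -> K l *m K j = 0.
  move=> jl; rewrite {2}/K mulmxBr !KSj ?subrr //; exact: ltnW.
have trS (l : 'I_r) : \tr (S l.+1 *m S l.+1) = \sum_(j < r | (j <= l)%N) t j.
  have w0 := wt_gt0 R r l.
  have /mulfI : wt R r l ^+ 2 != 0 by rewrite gt_eqF // exprn_gt0.
  apply; rewrite -tra aE SSub -scalemxAl -scalemxAr scalerA mxtraceZ; congr (_ * _).
  move: (K_S l) (S_K l); move: (K l) (S l) => A B AB BA.
  rewrite mulmxDl mulmxBl !mulmxDr !(mulmxN, AB, BA, oppr0, add0r, addr0, opprK).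
  by rewrite addrC.
exists K; split => // [i j|j|l].
- rewrite -val_eqE neq_ltn => /orP[ij|]; last exact: KK.
  by apply: partial_cx_mul0 (KK _ _ ij); [have [] := Kcx j|have [] := Kcx i].
- have -> : \tr (K j *m K j) = \tr (S j.+1 *m S j.+1) - \tr (S j *m S j).
    rewrite SSub; move: (K_S j) (S_K j); move: (K j) (S j) => A B AB BA.
    by rewrite mulmxDl !mulmxDr AB BA addr0 add0r mxtraceD addrC addKr.
  rewrite trS; have jr := ltn_ord j.
  rewrite (bigD1 j) //=; apply/eqP; rewrite subr_eq addrC; apply/eqP.
  have -> : \sum_(i < r | (i <= j)%N && (i != j)) t i = \sum_(i < r | (i < j)%N) t i.
    by apply: eq_bigl => i; rewrite ltn_neqAle andbC -val_eqE.
  rewrite addrC; congr (_ + _).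
  have [j0|] := posnP j.
    by rewrite j0 S0 mulmx0 mxtrace0 big_pred0.
  case E : (j : nat) => [//|j'] _.
  have j'r : (j' < r)%N by rewrite E in jr; lia.
  by rewrite (trS (Ordinal j'r)).
- move=> lr; rewrite /component SE //.
  move: lr; rewrite leq_eqVlt => /orP[/eqP ->|lr].
    rewrite big_pred0 => [|j]; last by rewrite ltn_eqF.
    rewrite /wt ltnn scale1r sub0r /S /scaled_psum subnn expr0 invr1 scale1r.
    by apply/eqP; rewrite -addr_eq0 addrC; apply/eqP; rewrite -[RHS]suma big_ord_recr.
  by rewrite (big_pred1 (Ordinal lr)) ?(aE (Ordinal lr)) // => j; rewrite -val_eqE.
Qed.

(** * Conjugating families of partial complex structures *)

(** Partial isometries that intertwine the two families; the aim is to extend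
    them until they become orthogonal matrices. *)
Definition partial_intertwiner (R : pzRingType) N (I : Type)
    (E K : I -> 'M[R]_N) (S : 'M[R]_N) :=
  S *m S^T *m S = S /\ forall j, S *m E j = K j *m S.

Lemma skew_form0 (R : numDomainType) N (K : 'M[R]_N) (p : 'cV[R]_N) :
  K^T = - K -> p^T *m (K *m p) = 0.
Proof.
move=> Ks; have tr11 (A : 'M[R]_1) : A^T = A.
  by apply/matrixP => i j; rewrite mxE !ord1.
have := tr11 (p^T *m (K *m p)); rewrite !trmx_mul trmxK Ks mulmxN mulNmx -mulmxA.
move: (p^T *m _) => X /matrixP XN; apply/matrixP => i j.
by have /eqP := XN i j; rewrite !mxE eqNr => /eqP.
Qed.

Lemma partial_intertwinerD (R : comPzRingType) N (I : Type)
    (E K : I -> 'M[R]_N) (S T : 'M[R]_N) :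
  partial_intertwiner E K S -> partial_intertwiner E K T ->
  S *m T^T = 0 -> S^T *m T = 0 -> partial_intertwiner E K (S + T).
Proof.
move=> [SSS SE] [TTT TE] ST TS.
have ST' : T *m S^T = 0.
  by have := congr1 trmx ST; rewrite trmx_mul trmxK trmx0.
have TS' : T^T *m S = 0.
  by have := congr1 trmx TS; rewrite trmx_mul trmxK trmx0.
split; last by move=> j; rewrite mulmxDl mulmxDr SE TE.
rewrite trmxD mulmxDl !mulmxDr ST ST' addr0 add0r !mulmxDl SSS TTT.
by rewrite -!mulmxA TS TS' !mulmx0 addr0 add0r.
Qed.

(** [A] is an invariant projector, and [Q] the projector on the part of its
    range where [K] does not vanish. *)
Lemma partial_cx_cut (R : comPzRingType) N (K A : 'M[R]_N) :
  partial_cx K -> A^T = A -> A *m A = A -> A *m K = K *m A ->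
  let Q := - (K *m K *m A) in
  [/\ Q^T = Q, Q *m Q = Q, (Q == 0) = (K *m A == 0)
    & forall p : 'cV[R]_N, Q *m p = p -> A *m p = p /\ K *m (K *m p) = - p].
Proof.
move=> [Ks K3] As AA AK Q.
have AKK : A *m (K *m K) = K *m K *m A.
  by rewrite mulmxA AK -(mulmxA K A) AK mulmxA.
have AQ : A *m Q = Q by rewrite /Q mulmxN mulmxA AKK -(mulmxA (K *m K)) AA.
have KKQ : K *m (K *m Q) = - Q by rewrite /Q !mulmxN !mulmxA K3 !mulNmx.
split.
- by rewrite /Q trmxN !trmx_mul Ks As !(mulNmx, mulmxN, opprK) AKK.
- by rewrite {1}/Q mulNmx -(mulmxA _ A) AQ -mulmxA KKQ opprK.
- apply/eqP/eqP => [|KA]; last by rewrite /Q -mulmxA KA mulmx0 oppr0.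
  by move=> /(congr1 (mulmx K)); rewrite mulmx0 /Q mulmxN !mulmxA K3 mulNmx opprK.
- move=> p <-; split; first by rewrite mulmxA AQ.
  by rewrite (mulmxA K Q) (mulmxA K (K *m Q)) KKQ mulNmx.
Qed.

(** Either some [E j] is nonzero outside the initial space of [S], or all vanish
    there. In the first case the traces show that [K j] is nonzero outside the
    final space of [S]; then the plane of a unit vector [p] and of [E j p] can be
    mapped isometrically onto the plane of a similar [q] and of [K j q]. In the
    second case the [K j] vanish outside the final space too, and any unit vector
    can be sent to any other. *)
Lemma extend_intertwiner (R : rcfType) N (I : finType) (E K : I -> 'M[R]_N) S :
  (forall j, partial_cx (E j)) -> (forall i j, i != j -> E i *m E j = 0) ->
  (forall j, partial_cx (K j)) -> (forall i j, i != j -> K i *m K j = 0) ->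
  (forall j, \tr (E j *m E j) = \tr (K j *m K j)) ->
  partial_intertwiner E K S -> S^T *m S != 1%:M ->
  exists2 S', partial_intertwiner E K S' & \tr (S^T *m S) + 1 <= \tr (S'^T *m S').
Proof.
move=> Ecx EE Kcx KK trEK [SSS SE] S1.
have SSS' : S^T *m S *m S^T = S^T.
  by have := congr1 trmx SSS; rewrite !trmx_mul trmxK mulmxA.
have SK j : S^T *m K j = E j *m S^T.
  have := congr1 trmx (SE j); rewrite !trmx_mul (proj1 (Ecx j)) (proj1 (Kcx j)).
  by rewrite mulmxN mulNmx => /oppr_inj ->.
suff [T [Tin ST TS trT]] : exists T, [/\ partial_intertwiner E K T,
    S *m T^T = 0, S^T *m T = 0 & 1 <= \tr (T^T *m T)].
  exists (S + T); first exact: partial_intertwinerD.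
  have TS' : T^T *m S = 0.
    by have := congr1 trmx TS; rewrite trmx_mul trmxK trmx0.
  by rewrite trmxD mulmxDl !mulmxDr TS TS' addr0 add0r mxtraceD lerD2l.
pose A0 := 1%:M - S^T *m S; pose B0 := 1%:M - S *m S^T.
have A0s : A0^T = A0 by rewrite /A0 trmxD trmxN trmx1 trmx_mul trmxK.
have B0s : B0^T = B0 by rewrite /B0 trmxD trmxN trmx1 trmx_mul trmxK.
have SA0 : S *m A0 = 0 by rewrite /A0 mulmxBr mulmx1 mulmxA SSS subrr.
have SB0 : S^T *m B0 = 0 by rewrite /B0 mulmxBr mulmx1 mulmxA SSS' subrr.
have A0A0 : A0 *m A0 = A0.
  by rewrite {1}/A0 mulmxBl mul1mx -mulmxA SA0 mulmx0 subr0.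
have B0B0 : B0 *m B0 = B0.
  by rewrite {1}/B0 mulmxBl mul1mx -mulmxA SB0 mulmx0 subr0.
have A0E j : A0 *m E j = E j *m A0.
  by rewrite /A0 mulmxBl mulmxBr mul1mx mulmx1 -!mulmxA SE mulmxA SK -mulmxA.
have B0K j : B0 *m K j = K j *m B0.
  by rewrite /B0 mulmxBl mulmxBr mul1mx mulmx1 -!mulmxA SK (mulmxA S) SE -mulmxA.
have tr0 : \tr A0 = \tr B0.
  by rewrite /A0 /B0 !mxtraceD !mxtraceN mxtrace_mulC.
have trj j : \tr (E j *m E j *m A0) = \tr (K j *m K j *m B0).
  rewrite /A0 /B0 !mulmxBr !mulmx1 !mxtraceD !mxtraceN trEK; congr (_ - _).
  by rewrite mulmxA -(mulmxA _ _ S^T) -SK mulmxA -SK -!mulmxA mxtrace_mulC !mulmxA.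
have [[j Ej]|noE] := pselect (exists j, E j *m A0 <> 0).
- have [Es _] := Ecx j; have [Ks _] := Kcx j.
  have [As AA A0P ApP] := partial_cx_cut (Ecx j) A0s A0A0 (A0E j).
  have [Bs BB B0P BqP] := partial_cx_cut (Kcx j) B0s B0B0 (B0K j).
  have A_neq0 : - (E j *m E j *m A0) != 0 by rewrite A0P; apply/eqP.
  have B_neq0 : - (K j *m K j *m B0) != 0.
    by rewrite -(sym_idem_tr_eq0 Bs BB) mxtraceN -trj -mxtraceN sym_idem_tr_eq0.
  have [p [pp /ApP [A0p EEp]]] := sym_idem_unit_vector AA A_neq0.
  have [q [qq /BqP [B0q KKq]]] := sym_idem_unit_vector BB B_neq0.
  have Sp : S *m p = 0 by rewrite -A0p mulmxA SA0 mul0mx.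
  have Sq : S^T *m q = 0 by rewrite -B0q mulmxA SB0 mul0mx.
  have pEp := skew_form0 p Es; have qKq := skew_form0 q Ks.
  have Epp : (E j *m p)^T *m p = 0.
    by rewrite trmx_mul Es mulmxN mulNmx -mulmxA pEp oppr0.
  have Kqq : (K j *m q)^T *m q = 0.
    by rewrite trmx_mul Ks mulmxN mulNmx -mulmxA qKq oppr0.
  have EpEp : (E j *m p)^T *m (E j *m p) = 1%:M.
    by rewrite trmx_mul Es mulmxN mulNmx -mulmxA EEp mulmxN opprK.
  have KqKq : (K j *m q)^T *m (K j *m q) = 1%:M.
    by rewrite trmx_mul Ks mulmxN mulNmx -mulmxA KKq mulmxN opprK.
  pose T := q *m p^T + K j *m q *m (E j *m p)^T.
  have Tt : T^T = p *m q^T + E j *m p *m (K j *m q)^T.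
    by rewrite /T trmxD [X in X + _]trmx_mul [X in _ + X]trmx_mul !trmxK.
  have TtT : T^T *m T = p *m p^T + E j *m p *m (E j *m p)^T.
    rewrite Tt /T mulmxDl !mulmxDr.
    rewrite -(mulmxA p q^T) (mulmxA q^T q) qq mul1mx.
    rewrite -(mulmxA p q^T) (mulmxA q^T (K j *m q)) qKq mul0mx mulmx0 addr0.
    rewrite -[X in _ + (X + _)]mulmxA (mulmxA _ q) Kqq mul0mx mulmx0 add0r.
    by rewrite -[X in _ + X]mulmxA (mulmxA _ (K j *m q)) KqKq mul1mx.
  exists T; split; [split|..].
  - rewrite -mulmxA TtT /T mulmxDl !mulmxDr.
    rewrite -(mulmxA q p^T) (mulmxA p^T p) pp mul1mx.
    rewrite -(mulmxA q p^T) (mulmxA p^T (E j *m p)) pEp mul0mx mulmx0 addr0.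
    rewrite -[X in _ + (X + _)]mulmxA (mulmxA _ p) Epp mul0mx mulmx0 add0r.
    by rewrite -[X in _ + X]mulmxA (mulmxA _ (E j *m p)) EpEp mul1mx.
  - move=> i; have [->|ij] := eqVneq i j.
      rewrite /T mulmxDl mulmxDr -!mulmxA.
      have -> : p^T *m E j = - (E j *m p)^T by rewrite trmx_mul Es mulmxN opprK.
      have -> : (E j *m p)^T *m E j = p^T.
        rewrite -[RHS]opprK -trmxN -EEp [in RHS]trmx_mul Es mulmxN opprK.
        by [].
      rewrite (mulmxA (K j) (K j)) (mulmxA (K j *m K j)).
      by rewrite -(mulmxA (K j) (K j) q) KKq mulNmx mulmxN addrC.
    have Eip : E i *m p = 0.
      by rewrite -[p]opprK -EEp mulmxN (mulmxA (E i)) EE // mul0mx oppr0.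
    have Kiq : K i *m q = 0.
      by rewrite -[q]opprK -KKq mulmxN (mulmxA (K i)) KK // mul0mx oppr0.
    have pEi : p^T *m E i = 0.
      apply: trmx_inj; rewrite trmx_mul trmxK (proj1 (Ecx i)) mulNmx Eip oppr0.
      by rewrite trmx0.
    have pEjEi : (E j *m p)^T *m E i = 0.
      by rewrite trmx_mul Es mulmxN mulNmx -mulmxA EE 1?eq_sym // mulmx0 oppr0.
    rewrite /T mulmxDl mulmxDr -!mulmxA pEi pEjEi !mulmx0.
    by rewrite (mulmxA (K i) q) Kiq (mulmxA (K i) (K j)) KK // !mul0mx.
  - by rewrite Tt mulmxDr !mulmxA SE Sp -(mulmxA (K j)) Sp mulmx0 !mul0mx addr0.
  - by rewrite /T mulmxDr !mulmxA SK Sq -(mulmxA (E j)) Sq mulmx0 !mul0mx addr0.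
  - rewrite TtT mxtraceD mxtrace_mulC pp [X in _ + X]mxtrace_mulC EpEp.
    by rewrite mxtrace1 lerDl ler01.
have E0 j : E j *m A0 = 0 by apply: contrapT => h; apply: noE; exists j.
have K0 j : K j *m B0 = 0.
  apply/eqP; rewrite -tr_gram_eq0 trmx_mul (proj1 (Kcx j)) B0s mulmxN mulNmx.
  rewrite mxtraceN oppr_eq0 -!mulmxA mxtrace_mulC -!mulmxA B0B0 mulmxA -trj.
  by rewrite -mulmxA E0 mulmx0 mxtrace0.
have A_neq0 : A0 != 0 by rewrite subr_eq0 eq_sym.
have B_neq0 : B0 != 0 by rewrite -(sym_idem_tr_eq0 B0s B0B0) -tr0 sym_idem_tr_eq0.
have [p [pp Ap]] := sym_idem_unit_vector A0A0 A_neq0.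
have [q [qq Bq]] := sym_idem_unit_vector B0B0 B_neq0.
exists (q *m p^T); split; [split|..].
- by rewrite trmx_mul trmxK -!mulmxA (mulmxA p^T) pp mul1mx (mulmxA q^T) qq mul1mx.
- move=> j; rewrite -mulmxA -{1}Ap trmx_mul A0s -mulmxA A0E E0 mulmx0.
  by rewrite mulmxA -Bq mulmxA K0 !mul0mx mulmx0.
- by rewrite trmx_mul trmxK -Ap !mulmxA SA0 !mul0mx.
- by rewrite -Bq !mulmxA SB0 !mul0mx.
- rewrite trmx_mul trmxK -mulmxA (mulmxA q^T) qq mul1mx mxtrace_mulC pp.
  by rewrite mxtrace1.
Qed.

(** Starting from [0], [extend_intertwiner] increases the trace of [S^T *m S]
    by at least 1 at each step, whereas this trace cannot exceed [N]. *)
Lemma simultaneous_conj (R : rcfType) N (I : finType) (E K : I -> 'M[R]_N) :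
  (forall j, partial_cx (E j)) -> (forall i j, i != j -> E i *m E j = 0) ->
  (forall j, partial_cx (K j)) -> (forall i j, i != j -> K i *m K j = 0) ->
  (forall j, \tr (E j *m E j) = \tr (K j *m K j)) ->
  exists2 g : 'M[R]_N, g^T *m g = 1%:M & forall j, g *m E j = K j *m g.
Proof.
move=> Ecx EE Kcx KK trEK.
have ex k : exists2 S, partial_intertwiner E K S &
    S^T *m S = 1%:M \/ k%:R <= \tr (S^T *m S).
  elim: k => [|k [S Sin]].
    exists 0; last by right; rewrite tr_gram_ge0.
    by split=> [|j]; rewrite ?mulmx0 ?mul0mx.
  have [S1 _|S1] := eqVneq (S^T *m S) 1%:M; first by exists S => //; left.
  case=> [S1'|kS]; first by rewrite S1' eqxx in S1.
  have [S' S'in trS'] := extend_intertwiner Ecx EE Kcx KK trEK Sin S1.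
  exists S' => //; right; apply: le_trans trS'.
  by rewrite -natr1 lerD2r.
have [S [SSS SE] [S1|]] := ex N.+1; first by exists S.
have S_idem : (1%:M - S^T *m S) *m (1%:M - S^T *m S) = 1%:M - S^T *m S.
  have PP : S^T *m S *m (S^T *m S) = S^T *m S by rewrite -mulmxA (mulmxA S) SSS.
  by rewrite mulmxBr mulmx1 mulmxBl mul1mx PP subrr subr0.
have := tr_gram_ge0 (1%:M - S^T *m S).
rewrite trmxD trmxN trmx1 trmx_mul trmxK S_idem mxtraceD mxtraceN mxtrace1.
by rewrite subr_ge0 => h1 h2; have := le_trans h2 h1; rewrite ler_nat ltnn.
Qed.

(** * Complexification *)

Definition adjm (R : realType) m n (A : 'M[R[i]]_(m, n)) : 'M[R[i]]_(n, m) :=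
  (map_mx conjc A)^T.

Lemma cplxM (R : realType) m n p (A : 'M[R]_(m, n)) (B : 'M[R]_(n, p)) :
  cplx_mx (A *m B) = cplx_mx A *m cplx_mx B.
Proof. exact: map_mxM. Qed.

Lemma cplxN (R : realType) m n (A : 'M[R]_(m, n)) : cplx_mx (- A) = - cplx_mx A.
Proof. exact: map_mxN. Qed.

Lemma cplx0 (R : realType) m n : cplx_mx (0 : 'M[R]_(m, n)) = 0.
Proof. exact: map_mx0. Qed.

Lemma cplx1 (R : realType) n : cplx_mx (1%:M : 'M[R]_n) = 1%:M.
Proof. exact: map_mx1. Qed.

Lemma cplx_tr (R : realType) m n (A : 'M[R]_(m, n)) : cplx_mx A^T = (cplx_mx A)^T.
Proof. by rewrite /cplx_mx map_trmx. Qed.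

Lemma cplx_inj (R : realType) m n : injective (@cplx_mx R m n).
Proof. by apply: map_mx_inj => x y []. Qed.

Lemma conj_cplx (R : realType) m n (A : 'M[R]_(m, n)) :
  map_mx conjc (cplx_mx A) = cplx_mx A.
Proof. by apply/matrixP => i j; rewrite !mxE conjc_real. Qed.

Lemma conjmxK (R : realType) m n (A : 'M[R[i]]_(m, n)) :
  map_mx conjc (map_mx conjc A) = A.
Proof. by apply/matrixP => i j; rewrite !mxE conjcK. Qed.

Lemma adjmM (R : realType) m n p (A : 'M[R[i]]_(m, n)) (B : 'M[R[i]]_(n, p)) :
  adjm (A *m B) = adjm B *m adjm A.
Proof. by rewrite /adjm map_mxM trmx_mul. Qed.

Lemma adjmK (R : realType) m n (A : 'M[R[i]]_(m, n)) : adjm (adjm A) = A.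
Proof. by rewrite /adjm map_trmx trmxK conjmxK. Qed.

Lemma adjm_gram_eq0 (R : realType) n (v : 'cV[R[i]]_n) :
  adjm v *m v = 0 -> v = 0.
Proof.
move=> /matrixP /(_ 0 0); rewrite !mxE => h.
apply/matrixP => i j; rewrite ord1 [RHS]mxE.
have {}h : \sum_j `|v j 0| ^+ 2 = 0.
  by rewrite -[RHS]h; apply: eq_bigr => k _; rewrite !mxE normCKC.
move/eqP: h; rewrite psumr_eq0 => [/allP /(_ i (mem_index_enum i))|k _].
  by rewrite /= sqrf_eq0 normr_eq0 => /eqP.
by rewrite exprn_ge0.
Qed.

Lemma conjc_i (R : realType) : conjc ('i%C : R[i]) = - 'i%C.
Proof. by apply/eqP; rewrite eq_complex /= oppr0 !eqxx. Qed.

(** A real matrix that commutes with a complex structure is complex linear, so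
    its determinant is the squared modulus of a complex one. To stay clear of
    a choice of basis, write [P] and [Q] for the projectors on the two
    eigenspaces of [J], which are conjugate: then
    [g = (g P + Q) (g Q + P)], a product of two conjugate matrices. *)
Lemma det_commuting_cx_ge0 (R : realType) n (g J : 'M[R]_n) :
  J *m J = - 1%:M -> g *m J = J *m g -> 0 <= \det g.
Proof.
move=> JJ gJ; pose H := 'i%C *: cplx_mx J.
have HH : H *m H = 1%:M.
  rewrite /H -scalemxAl -scalemxAr scalerA -cplxM JJ cplxN cplx1.
  by rewrite -expr2 sqr_i scaleN1r opprK.
have Hc : map_mx conjc H = - H.
  by rewrite -scaleNr -conjc_i map_mxZ conj_cplx.
have gH : cplx_mx g *m H = H *m cplx_mx g.
  by rewrite /H -scalemxAr -scalemxAl -!cplxM gJ.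
pose P := 2^-1 *: (1%:M + H); pose Q := 2^-1 *: (1%:M - H).
pose A := cplx_mx g *m P + Q.
have PQ : P + Q = 1%:M.
  by rewrite /P /Q -scalerDr addrACA subrr addr0 -[X in X + X]scale1r -scalerDl
   scalerA mulVf ?scale1r ?pnatr_eq0.
have PQ0 : P *m Q = 0.
  by rewrite /P /Q -scalemxAl -scalemxAr mulmxDl !mulmxBr HH !mul1mx mulmx1
   addrA subrK subrr !scaler0.
have QP0 : Q *m P = 0.
  by rewrite /P /Q -scalemxAl -scalemxAr mulmxBl !mulmxDr HH !mul1mx mulmx1
   opprD addrA addrK subrr !scaler0.
have Pi : P *m P = P by rewrite -[RHS]mulmx1 -PQ mulmxDr PQ0 addr0.
have Qi : Q *m Q = Q by rewrite -[RHS]mulmx1 -PQ mulmxDr QP0 add0r.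
have gP : cplx_mx g *m P = P *m cplx_mx g.
  by rewrite /P -scalemxAl -scalemxAr mulmxDl mulmxDr gH mulmx1 mul1mx.
have Ac : map_mx conjc A = cplx_mx g *m Q + P.
  have Pc : map_mx conjc P = Q.
    by rewrite map_mxZ map_mxD map_mx1 Hc fmorphV rmorph_nat.
  by rewrite map_mxD map_mxM conj_cplx Pc -[in RHS](conjmxK P) Pc.
have gE : cplx_mx g = A *m map_mx conjc A.
  have gQ : cplx_mx g *m Q = Q *m cplx_mx g.
    by rewrite /Q -scalemxAl -scalemxAr mulmxBl mulmxBr gH mulmx1 mul1mx.
  have PGQ : cplx_mx g *m P *m (cplx_mx g *m Q) = 0.
    by rewrite -mulmxA (mulmxA P) -gP -(mulmxA _ P) PQ0 !mulmx0.
  have QGQ : Q *m (cplx_mx g *m Q) = cplx_mx g *m Q.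
    by rewrite mulmxA -gQ -mulmxA Qi.
  by rewrite Ac /A mulmxDl !mulmxDr PGQ -(mulmxA _ P P) Pi QGQ QP0 add0r addr0
    -mulmxDr PQ mulmx1.
have := congr1 determinant gE.
rewrite det_mulmx !det_map_mx /= -sqr_normc => detE.
by rewrite -(@ler0c R) detE exprn_ge0.
Qed.

(** * Orthogonal projectors onto complex subspaces *)

Lemma half_double (F : numFieldType) (V : lmodType F) (v : V) :
  2^-1 *: (v + v) = v.
Proof.
by rewrite -[X in X + X]scale1r -scalerDl scalerA mulVf ?scale1r // pnatr_eq0.
Qed.

Definition is_orthoproj (R : realType) N (P : 'M[R[i]]_N)
    (x : {vspace 'cV[R[i]]_N}) :=
  [/\ adjm P = P, forall u, P *m u \in x & forall u, u \in x -> P *m u = u].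

Lemma is_orthoproj_mem (R : realType) N (P : 'M[R[i]]_N) x u :
  is_orthoproj P x -> (u \in x) = (P *m u == u).
Proof.
by case=> _ Px Pu; apply/idP/eqP => [/Pu|<-].
Qed.

Lemma mulmx_colP (R : pzRingType) m n (A B : 'M[R]_(m, n)) :
  (forall u : 'cV_n, A *m u = B *m u) -> A = B.
Proof.
move=> AB; apply/matrixP => i j.
have := AB (delta_mx j 0); rewrite -!colE => /matrixP /(_ i 0).
by rewrite !mxE.
Qed.

Lemma is_orthoproj_uniq (R : realType) N (P Q : 'M[R[i]]_N) x :
  is_orthoproj P x -> is_orthoproj Q x -> P = Q.
Proof.
move=> [Ps Px Pu] [Qs Qx Qu].
have PQ : P *m Q = Q by apply: mulmx_colP => u; rewrite -mulmxA Pu.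
have QP : Q *m P = P by apply: mulmx_colP => u; rewrite -mulmxA Qu.
by rewrite -QP -Ps -{1}Qs -adjmM PQ Qs.
Qed.

Definition basis_mx (R : realType) N (x : {vspace 'cV[R[i]]_N}) :
    'M[R[i]]_(N, \dim x) :=
  \matrix_(k, j) (vbasis x)`_j k 0.

(** The classical [B (B^* B)^-1 B^*], for the matrix [B] of a basis. *)
Definition orthoproj (R : realType) N (x : {vspace 'cV[R[i]]_N}) : 'M[R[i]]_N :=
  let B := basis_mx x in B *m invmx (adjm B *m B) *m adjm B.

Lemma basis_mxE (R : realType) N (x : {vspace 'cV[R[i]]_N}) (w : 'cV_(\dim x)) :
  basis_mx x *m w = \sum_(j < \dim x) w j 0 *: (vbasis x)`_j.
Proof.
apply/matrixP => k l; rewrite ord1 summxE !mxE.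
by apply: eq_bigr => j _; rewrite !mxE mulrC.
Qed.

Lemma basis_mx_mem (R : realType) N (x : {vspace 'cV[R[i]]_N}) w :
  basis_mx x *m w \in x.
Proof.
rewrite basis_mxE memv_suml // => j _; apply: memvZ; apply: vbasis_mem.
by rewrite mem_nth // size_tuple.
Qed.

Lemma basis_mx_span (R : realType) N (x : {vspace 'cV[R[i]]_N}) u :
  u \in x -> exists w, u = basis_mx x *m w.
Proof.
move=> ux; exists (\col_j coord (vbasis x) j u).
rewrite basis_mxE {1}(coord_vbasis ux).
by apply: eq_bigr => j _; rewrite mxE.
Qed.

Lemma basis_mx_gram_unit (R : realType) N (x : {vspace 'cV[R[i]]_N}) :
  adjm (basis_mx x) *m basis_mx x \in unitmx.
Proof.
set B := basis_mx x.
rewrite -row_free_unit; apply: inj_row_free => v vG.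
suff h : adjm v = 0 by rewrite -[v]adjmK h /adjm map_mx0 trmx0.
have Bw : B *m adjm v = 0.
  apply: adjm_gram_eq0; rewrite adjmM adjmK mulmxA -(mulmxA v) vG.
  by rewrite mul0mx.
apply/matrixP => j k; rewrite ord1 [RHS]mxE.
have /freeP h := basis_free (vbasisP x).
by apply: (h (fun j => adjm v j 0)); rewrite -basis_mxE.
Qed.

Lemma orthoprojP (R : realType) N (x : {vspace 'cV[R[i]]_N}) :
  is_orthoproj (orthoproj x) x.
Proof.
rewrite /orthoproj; set B := basis_mx x.
have Gu : adjm B *m B \in unitmx := basis_mx_gram_unit x.
split.
- rewrite !adjmM adjmK mulmxA; congr (_ *m _ *m _).
  have -> A : adjm (invmx A) = invmx (adjm A) by rewrite /adjm map_invmx trmx_inv.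
  by rewrite adjmM adjmK.
- by move=> u; rewrite -!mulmxA basis_mx_mem.
- move=> u /basis_mx_span[w ->]; rewrite -/B -!mulmxA (mulmxA (adjm B)).
  by rewrite (mulmxA (invmx _)) mulVmx // mul1mx.
Qed.

Lemma tr_orthoproj (R : realType) N (x : {vspace 'cV[R[i]]_N}) :
  \tr (orthoproj x) = (\dim x)%:R.
Proof.
rewrite /orthoproj -mulmxA mxtrace_mulC -mulmxA mulVmx ?mxtrace1 //.
exact: basis_mx_gram_unit.
Qed.

(** If [P] projects on an isotropic plane, the structure sought is [K] with
    [i K = P - P^*], that is, twice the imaginary part of [P]. *)
Definition cx_of (R : realType) N (x : {vspace 'cV[R[i]]_N}) : 'M[R]_N :=
  map_mx (fun z : R[i] => complex.Im z *+ 2) (orthoproj x).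

Lemma i_cx_of (R : realType) N (x : {vspace 'cV[R[i]]_N}) (P : 'M[R[i]]_N) :
  is_orthoproj P x ->
  'i%C *: cplx_mx (cx_of x) = P - map_mx conjc P.
Proof.
move=> /is_orthoproj_uniq /(_ (orthoprojP x)) ->.
apply/matrixP => i j; rewrite !mxE subcJ mulrC; congr (_ * _).
by rewrite mulr_natl rmorphMn.
Qed.

Lemma scale_i_inj (R : realType) m n (A B : 'M[R]_(m, n)) :
  'i%C *: cplx_mx A = 'i%C *: cplx_mx B -> A = B.
Proof.
move=> /(congr1 (fun M => - 'i%C *: M)).
rewrite !scalerA mulNr -expr2 sqr_i opprK !scale1r.
exact: cplx_inj.
Qed.

Lemma cx_of_eq (R : realType) N (x : {vspace 'cV[R[i]]_N}) P (K : 'M[R]_N) :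
  is_orthoproj P x -> P - map_mx conjc P = 'i%C *: cplx_mx K -> cx_of x = K.
Proof. by move=> /i_cx_of <- /scale_i_inj. Qed.

(** The spectral projector of [i K] for the eigenvalue 1, as
    [(t^2 + t) / 2] takes the values 1, 0 and 0 at [t = 1], [-1] and [0]. *)
Definition cx_proj (R : realType) N (K : 'M[R]_N) : 'M[R[i]]_N :=
  let H := 'i%C *: cplx_mx K in 2^-1 *: (H *m H + H).

Section partial_cx_planes.
Context {R : realType} {N : nat}.
Implicit Types (K : 'M[R]_N) (v : 'cV[R[i]]_N).

Lemma iK_cube K : partial_cx K ->
  let H := 'i%C *: cplx_mx K in H *m H *m H = H.
Proof.
move=> [_ K3] H; rewrite /H -!scalemxAl -!scalemxAr -!scalemxAl -!cplxM K3 cplxN.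
by rewrite !scalerA -expr2 sqr_i mulrN1 scaleNr scalerN opprK.
Qed.

Lemma conj_iK K : map_mx conjc ('i%C *: cplx_mx K) = - ('i%C *: cplx_mx K).
Proof. by rewrite -scaleNr -conjc_i map_mxZ conj_cplx. Qed.

Lemma conj_cx_proj K : map_mx conjc (cx_proj K) =
  let H := 'i%C *: cplx_mx K in 2^-1 *: (H *m H - H).
Proof.
rewrite /cx_proj map_mxZ map_mxD map_mxM !conj_iK mulNmx mulmxN opprK.
by rewrite fmorphV rmorph_nat.
Qed.

Lemma cx_proj_mem K v : partial_cx K ->
  (cx_proj K *m v = v) <-> ('i%C *: cplx_mx K) *m v = v.
Proof.
move=> /iK_cube; rewrite /cx_proj; set H := 'i%C *: _ => /= H3.
split=> [<-|Hv].
  by rewrite mulmxA -scalemxAr mulmxDr mulmxA H3 addrC.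
rewrite -scalemxAl mulmxDl -mulmxA !Hv.
by rewrite half_double.
Qed.

End partial_cx_planes.

(** * Planes of partial complex structures *)

Lemma char_poly_tr (R : comNzRingType) n (A : 'M[R]_n) :
  char_poly A^T = char_poly A.
Proof.
rewrite /char_poly -[RHS]det_tr; congr (\det _).
by apply/matrixP => i j; rewrite !mxE eq_sym.
Qed.

(** A sum of eigenspaces of which at most one is nonzero. *)
Lemma memv_sum_leigenspace (F : fieldType) (V : vectType F) (L : 'End(V))
    (s : seq F) (p : pred F) (c : F) v :
  p c -> (forall a u, L u = a *: u -> u != 0 -> p a -> a = c) ->
  (forall u, L u = c *: u -> u != 0 -> c \in s) ->
  (v \in \sum_(a <- s | p a) passmx.leigenspace L a)%VS = (L v == c *: v).
Proof.
move=> pc p_uniq cs.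
have memE a u : (u \in passmx.leigenspace L a) = (L u == a *: u).
  by rewrite memv_ker !lfun_simp subr_eq0.
rewrite -memE; apply/idP/idP.
  apply: subvP; elim/big_ind: _ => [|U W UV WV|a a0]; first exact: sub0v.
    by rewrite subv_add UV WV.
  apply/subvP => u; rewrite !memE => /eqP Lu.
  have [->|u0] := eqVneq u 0; first by rewrite linear0 scaler0.
  by rewrite Lu (p_uniq a u).
rewrite memE => /eqP Lv.
have [->|v0] := eqVneq v 0; first exact: mem0v.
rewrite (big_rem _ (cs _ Lv v0)) /= pc.
by apply: (subvP (addvSl _ _)); rewrite memE Lv.
Qed.

(** The cubic equation leaves [c] as the only possible positive eigenvalue. *)
Lemma pos_planeP (R : realType) N (A : 'M[R]_N) (c : R) v :
  0 < c -> A *m A *m A = - (c ^+ 2 *: A) ->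
  (v \in pos_plane A) = ('i%C *: cplx_mx A *m v == c%:C *: v).
Proof.
move=> c0 A3; rewrite /pos_plane /pos_eigenspace; set H := 'i%C *: _.
have H3 : H *m H *m H = (c ^+ 2)%:C *: H.
  rewrite /H -!scalemxAl -!scalemxAr -!scalemxAl -!cplxM A3 cplxN.
  rewrite /cplx_mx map_mxZ !scalerA -expr2 sqr_i mulrN1 scaleNr scalerN opprK.
  by rewrite scalerA mulrC.
have Hpow a (u : 'cV_N) : H *m u = a *: u -> u != 0 -> 0 < a -> a = c%:C.
  move=> Hu u0 a0.
  have : H *m H *m H *m u = (c ^+ 2)%:C *: H *m u by rewrite H3.
  rewrite -scalemxAl Hu -!mulmxA Hu -!scalemxAr Hu -!scalemxAr ?Hu !scalerA.
  move=> /eqP; rewrite -subr_eq0 -scalerBl scaler_eq0 (negPf u0) orbF subr_eq0.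
  have c0' : 0 < c%:C :> R[i] by rewrite ltcR.
  rewrite rmorphXn /= (inj_eq (mulIf (lt0r_neq0 a0))) -expr2 eqf_sqr.
  case/orP => /eqP // aE; move: a0; rewrite aE oppr_gt0 => /(lt_trans c0').
  by rewrite ltxx.
case: closed_field_poly_normal => s /= sE.
have LE u : linfun (mulmx H) u = H *m u by rewrite lfunE.
rewrite (@memv_sum_leigenspace _ _ _ _ _ c%:C) ?LE //.
- by rewrite ltcR.
- by move=> a u; rewrite LE; exact: Hpow.
move=> u; rewrite LE => Hu u0; have : root (char_poly H) c%:C.
  rewrite -char_poly_tr -eigenvalue_root_char; apply/eigenvalueP.
  exists u^T; last by rewrite -[_ == 0](inj_eq trmx_inj) trmxK trmx0.
  by rewrite -trmx_mul Hu trmxZ.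
by rewrite sE (monicP (char_poly_monic H)) scale1r root_prod_XsubC.
Qed.

Lemma mem_image_sub (R : realType) N (g : 'M[R]_N) x v :
  g^T *m g = 1%:M -> (v \in image_sub g x) = (cplx_mx g^T *m v \in x).
Proof.
move=> gg; have gg' := mulmx1C gg.
apply/memv_imgP/idP => [[u ux ->]|gv].
  by rewrite lfunE /= mulmxA -cplxM gg cplx1 mul1mx.
exists (cplx_mx g^T *m v) => //.
by rewrite lfunE /= mulmxA -cplxM gg' cplx1 mul1mx.
Qed.

Lemma mem_conj_sub (R : realType) N (x : {vspace 'cV[R[i]]_N}) v :
  (v \in conj_sub x) = (map_mx conjc v \in x).
Proof.
rewrite /conj_sub; set X := [seq _ | _ <- _].
have Xs : size X == \dim x by rewrite size_map size_tuple.
have XE (j : 'I_(\dim x)) : X`_j = map_mx conjc (vbasis x)`_j.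
  by rewrite (nth_map 0) // size_tuple.
apply/idP/idP => [|vx].
  move=> /(@coord_span _ _ _ (Tuple Xs)) ->; rewrite map_mx_sum.
  apply: memv_suml => j _; rewrite map_mxZ; apply: memvZ.
  by rewrite /= XE conjmxK vbasis_mem // mem_nth // size_tuple.
rewrite -[v]conjmxK (coord_vbasis vx) map_mx_sum.
apply: memv_suml => j _; rewrite map_mxZ; apply: memvZ; rewrite -XE.
by rewrite memv_span // mem_nth // (eqP Xs).
Qed.

Lemma partial_cx_cube (R : comPzRingType) N (K : 'M[R]_N) (c : R) :
  partial_cx K ->
  let A := c *: K in A *m A *m A = - (c ^+ 2 *: A).
Proof.
move=> [_ K3] A; rewrite /A -!scalemxAl -!scalemxAr -!scalemxAl K3 !scalerA.
by rewrite scalerN expr2 mulrA.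
Qed.

Lemma mem_pos_plane (R : realType) N (K : 'M[R]_N) c v :
  partial_cx K -> 0 < c ->
  (v \in pos_plane (c *: K)) = ('i%C *: cplx_mx K *m v == v).
Proof.
move=> Kcx c0; rewrite (pos_planeP _ c0 (partial_cx_cube c Kcx)).
rewrite /cplx_mx map_mxZ scalerA mulrC -scalerA -scalemxAl.
apply: (inj_eq (scalerI _)).
by rewrite gt_eqF // ltcR.
Qed.

Lemma mem_pos_plane1 (R : realType) N (K : 'M[R]_N) v :
  partial_cx K -> (v \in pos_plane K) = ('i%C *: cplx_mx K *m v == v).
Proof. by move=> Kcx; rewrite -(mem_pos_plane _ Kcx ltr01) scale1r. Qed.

Lemma cx_proj_orthoproj (R : realType) N (K : 'M[R]_N) :
  partial_cx K -> is_orthoproj (cx_proj K) (pos_plane K).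
Proof.
move=> Kcx; have H3 := iK_cube Kcx; split => [|u|u].
- rewrite /adjm conj_cx_proj /cx_proj trmxZ trmxD trmxN trmx_mul.
  by rewrite trmxZ -cplx_tr (proj1 Kcx) cplxN scalerN opprK mulNmx mulmxN opprK.
- rewrite mem_pos_plane1 // mulmxA; apply/eqP; congr (_ *m _).
  by rewrite /cx_proj -scalemxAr mulmxDr mulmxA H3 addrC.
- by rewrite mem_pos_plane1 // => /eqP; move/(cx_proj_mem _ Kcx).
Qed.

Lemma cx_of_pos_plane (R : realType) N (K : 'M[R]_N) :
  partial_cx K -> cx_of (pos_plane K) = K.
Proof.
move=> Kcx; apply: (cx_of_eq (cx_proj_orthoproj Kcx)).
rewrite conj_cx_proj /cx_proj -scalerBr opprD opprK addrACA subrr add0r.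
exact: half_double.
Qed.

(** The trace of a skew-symmetric matrix vanishes, so only the quadratic part
    of the projector contributes. *)
Lemma tr_cx_proj (R : realType) N (K : 'M[R]_N) :
  partial_cx K -> \tr (cx_proj K) = (- (\tr (K *m K) / 2))%:C.
Proof.
move=> Kcx; rewrite /cx_proj mxtraceZ mxtraceD mxtraceZ trace_map_mx.
have -> : \tr K = 0.
  have := mxtrace_tr K; rewrite (proj1 Kcx) mxtraceN => /eqP.
  by rewrite eqNr => /eqP.
rewrite -scalemxAl -scalemxAr scalerA -cplxM -expr2 sqr_i scaleN1r mxtraceN.
rewrite trace_map_mx /= mulr0 addr0 mulrN rmorphN rmorphM fmorphV rmorph_nat.
by rewrite mulrC.
Qed.

Lemma dim_pos_plane (R : realType) N (K : 'M[R]_N) d :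
  partial_cx K -> \tr (K *m K) = - (2 * d%:R) -> \dim (pos_plane K) = d.
Proof.
move=> Kcx trK; apply/eqP; rewrite -(eqr_nat R[i]) -tr_orthoproj.
rewrite (is_orthoproj_uniq (orthoprojP _) (cx_proj_orthoproj Kcx)).
by rewrite tr_cx_proj // trK mulNr opprK mulrC mulKf ?pnatr_eq0 // rmorph_nat.
Qed.

Lemma eq_opp_mx0 (R : numDomainType) m n (X : 'M[R]_(m, n)) : X = - X -> X = 0.
Proof.
move=> /matrixP XN; apply/matrixP => i j.
by have /esym /eqP := XN i j; rewrite !mxE eqNr => /eqP.
Qed.

Lemma trmx_mul_eq0 (R : comPzRingType) m n p (A : 'M[R]_(m, n)) (B : 'M[R]_(m, p)) :
  (forall (u : 'cV_n) (w : 'cV_p), (A *m u)^T *m (B *m w) = 0) -> A^T *m B = 0.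
Proof.
move=> AB; apply/matrixP => i j.
have := AB (delta_mx i 0) (delta_mx j 0); rewrite -!colE => /matrixP /(_ 0 0).
rewrite !mxE => h; rewrite -[RHS]h; apply: eq_bigr => k _.
by rewrite !mxE.
Qed.

Lemma trmx_orthoproj (R : realType) N (x : {vspace 'cV[R[i]]_N}) :
  (orthoproj x)^T = map_mx conjc (orthoproj x).
Proof. by have [Ps _ _] := orthoprojP x; rewrite -[in LHS]Ps /adjm trmxK. Qed.

(** Since an orthogonal projector is Hermitian, its conjugate is its transpose;
    bilinear orthogonality of planes thus becomes the vanishing of a product. *)
Lemma conj_orthoproj_mul0 (R : realType) N (x y : {vspace 'cV[R[i]]_N}) :
  (forall u v : 'cV[R[i]]_N, u \in x -> v \in y -> u^T *m v = 0) ->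
  map_mx conjc (orthoproj x) *m orthoproj y = 0.
Proof.
move=> xy; rewrite -trmx_orthoproj; apply: trmx_mul_eq0 => u w.
by apply: xy; [have [_ + _] := orthoprojP x|have [_ + _] := orthoprojP y]; apply.
Qed.

Lemma orthoproj_mul0 (R : realType) N (x y : {vspace 'cV[R[i]]_N}) :
  orthogonal_sub x y -> orthoproj x *m orthoproj y = 0.
Proof.
move=> xy; have [Ps Px _] := orthoprojP x; have [_ Py _] := orthoprojP y.
rewrite -Ps; apply: trmx_mul_eq0 => u w.
rewrite -[u]conjmxK -map_mxM; apply: xy; [exact: Px|exact: Py].
Qed.

Lemma i_cx_of_orthoproj (R : realType) N (x : {vspace 'cV[R[i]]_N}) :
  'i%C *: cplx_mx (cx_of x) = orthoproj x - map_mx conjc (orthoproj x).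
Proof. exact/i_cx_of/orthoprojP. Qed.

Lemma mulmx_conj_eq0 (R : realType) N (P Q : 'M[R[i]]_N) :
  map_mx conjc P *m Q = 0 -> P *m map_mx conjc Q = 0.
Proof.
by move=> /(congr1 (map_mx conjc)); rewrite map_mxM conjmxK map_mx0.
Qed.

Lemma orthoproj_idem (R : realType) N (x : {vspace 'cV[R[i]]_N}) :
  orthoproj x *m orthoproj x = orthoproj x.
Proof.
have [_ Px Pu] := orthoprojP x.
by apply: mulmx_colP => u; rewrite -mulmxA Pu.
Qed.

(** For an isotropic plane, the projector [P] and its conjugate [Q] annihilate
    each other, so [P - Q] is its own cube. *)
Lemma partial_cx_of (R : realType) N (x : {vspace 'cV[R[i]]_N}) :
  isotropic_sub x -> partial_cx (cx_of x).
Proof.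
move=> /conj_orthoproj_mul0 QP; have PQ := mulmx_conj_eq0 QP.
have PP := orthoproj_idem x.
have QQ := congr1 (map_mx conjc) PP; rewrite map_mxM in QQ.
have HE := i_cx_of_orthoproj x; have Pt := trmx_orthoproj x.
move: (orthoproj x) (map_mx conjc _) Pt HE PP QQ QP PQ => P Q Pt HE PP QQ QP PQ.
split; apply: scale_i_inj; rewrite cplxN.
  by rewrite cplx_tr -trmxZ HE scalerN HE trmxD trmxN Pt -Pt trmxK opprB.
have -> : 'i%C *: cplx_mx (cx_of x *m cx_of x *m cx_of x) = - (
    ('i%C *: cplx_mx (cx_of x)) *m ('i%C *: cplx_mx (cx_of x)) *m
    ('i%C *: cplx_mx (cx_of x))).
  rewrite !cplxM -!scalemxAl -!scalemxAr -!scalemxAl !scalerA -expr2 sqr_i.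
  by rewrite mulrN1 scaleNr opprK.
rewrite scalerN HE; congr (- _).
have -> : (P - Q) *m (P - Q) = P + Q.
  by rewrite mulmxBl !mulmxBr PP QQ PQ QP subr0 sub0r opprK.
by rewrite mulmxDl !mulmxBr PP QQ PQ QP subr0 sub0r.
Qed.

Lemma pos_plane_cx_of (R : realType) N (x : {vspace 'cV[R[i]]_N}) :
  isotropic_sub x -> pos_plane (cx_of x) = x.
Proof.
move=> iso; have Kcx := partial_cx_of iso.
apply/vspaceP => v; rewrite mem_pos_plane1 // i_cx_of_orthoproj.
have QP := conj_orthoproj_mul0 iso; have PQ := mulmx_conj_eq0 QP.
have PP := orthoproj_idem x.
rewrite (is_orthoproj_mem _ (orthoprojP x)).
have QQ := congr1 (map_mx conjc) PP; rewrite map_mxM in QQ.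
apply/eqP/eqP => [Hv|Pv].
  have Qv : map_mx conjc (orthoproj x) *m v = 0.
    by apply: eq_opp_mx0; rewrite -{1}Hv mulmxA mulmxBr QP QQ sub0r mulNmx.
  by move: Hv; rewrite mulmxBl Qv subr0.
by rewrite mulmxBl -{2}Pv mulmxA QP mul0mx subr0.
Qed.

Lemma tr_cx_of (R : realType) N (x : {vspace 'cV[R[i]]_N}) :
  isotropic_sub x -> \tr (cx_of x *m cx_of x) = - (2 * (\dim x)%:R).
Proof.
move=> iso; have Kcx := partial_cx_of iso.
have := tr_orthoproj x; rewrite -{1}(pos_plane_cx_of iso).
rewrite (is_orthoproj_uniq (orthoprojP _) (cx_proj_orthoproj Kcx)) tr_cx_proj //.
rewrite -(rmorph_nat (real_complex R)) => /complexI <-.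
by field.
Qed.

Lemma cx_of_mul0 (R : realType) N r (x : 'I_r -> {vspace 'cV[R[i]]_N}) :
  (forall j k, j != k -> orthogonal_sub (x j) (x k)) ->
  isotropic_sub (\sum_(j < r) x j)%VS ->
  forall j k, j != k -> cx_of (x j) *m cx_of (x k) = 0.
Proof.
move=> ortho iso j k jk.
have sub l u : u \in x l -> u \in (\sum_(j < r) x j)%VS.
  by apply/subvP; rewrite (bigD1 l) //= addvSl.
have PP := orthoproj_mul0 (ortho _ _ jk).
have QP : map_mx conjc (orthoproj (x j)) *m orthoproj (x k) = 0.
  by apply: conj_orthoproj_mul0 => u v uj vk; apply: iso; [exact: sub uj|exact: sub vk].
have PQ := mulmx_conj_eq0 QP.
have QQ := congr1 (map_mx conjc) PP; rewrite map_mxM map_mx0 in QQ.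
apply: cplx_inj; rewrite cplxM cplx0.
have : ('i%C *: cplx_mx (cx_of (x j))) *m ('i%C *: cplx_mx (cx_of (x k))) = 0.
  by rewrite !i_cx_of_orthoproj mulmxBl !mulmxBr PP QQ PQ QP !subr0.
rewrite -scalemxAl -scalemxAr scalerA -expr2 sqr_i scaleN1r => /eqP.
by rewrite oppr_eq0 => /eqP.
Qed.

Lemma adjm_iK (R : realType) N (K : 'M[R]_N) :
  K^T = - K -> adjm ('i%C *: cplx_mx K) = 'i%C *: cplx_mx K.
Proof.
by move=> Ks; rewrite /adjm conj_iK trmxN trmxZ -cplx_tr Ks cplxN scalerN opprK.
Qed.

Lemma orthogonal_pos_plane (R : realType) N (K L : 'M[R]_N) :
  partial_cx K -> partial_cx L -> K *m L = 0 ->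
  orthogonal_sub (pos_plane K) (pos_plane L).
Proof.
move=> Kcx Lcx KL u v; rewrite !mem_pos_plane1 // => /eqP Hu /eqP Hv.
rewrite -/(adjm u) -Hu -Hv adjmM (adjm_iK (proj1 Kcx)) -mulmxA (mulmxA (_ *: _)).
by rewrite -scalemxAl -scalemxAr -cplxM KL cplx0 !scaler0 mul0mx mulmx0.
Qed.

(** Moving [i K] across the bilinear form changes its sign. For one and the same
    plane this gives [u^T v = - u^T v]; for distinct planes the product of the
    two structures vanishes. *)
Lemma isotropic_sum_pos_plane (R : realType) N r (K : 'I_r -> 'M[R]_N) :
  (forall j, partial_cx (K j)) -> (forall i j, i != j -> K i *m K j = 0) ->
  isotropic_sub (\sum_(j < r) pos_plane (K j))%VS.
Proof.
move=> Kcx KK u v /memv_sumP[us hus ->] /memv_sumP[vs hvs ->].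
rewrite mulmx_sumr big1 // => j _.
rewrite (raddf_sum (@trmx _ _ _)) mulmx_suml big1 // => k _.
have := hus k isT; have := hvs j isT; rewrite !mem_pos_plane1 // => /eqP Hv /eqP Hu.
have h : (us k)^T *m vs j = - ((us k)^T *m ('i%C *: cplx_mx (K k) *m vs j)).
  rewrite -[in LHS]Hu trmx_mul trmxZ -cplx_tr (proj1 (Kcx k)) cplxN scalerN.
  by rewrite mulmxN mulNmx mulmxA.
have [jk|kj] := eqVneq k j.
  by move: h; rewrite -jk in Hv *; rewrite Hv; exact: eq_opp_mx0.
rewrite h -Hv (mulmxA ('i%C *: cplx_mx (K k))).
by rewrite -scalemxAl -scalemxAr -cplxM KK // cplx0 !scaler0 mul0mx mulmx0 oppr0.
Qed.

Lemma is_orthoproj_image (R : realType) N (g : 'M[R]_N) P x :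
  g^T *m g = 1%:M -> is_orthoproj P x ->
  is_orthoproj (cplx_mx g *m P *m cplx_mx g^T) (image_sub g x).
Proof.
move=> gg [Ps Px Pu]; split.
- by rewrite !adjmM Ps /adjm !conj_cplx -!cplx_tr trmxK mulmxA.
- move=> u; rewrite mem_image_sub // !mulmxA -cplxM gg cplx1 mul1mx -mulmxA.
  exact: Px.
- move=> u; rewrite mem_image_sub // -!mulmxA => /Pu ->.
  by rewrite mulmxA -cplxM (mulmx1C gg) cplx1 mul1mx.
Qed.

Lemma cx_of_image (R : realType) N (g : 'M[R]_N) x :
  g^T *m g = 1%:M -> cx_of (image_sub g x) = g *m cx_of x *m g^T.
Proof.
move=> gg; apply: (cx_of_eq (is_orthoproj_image gg (orthoprojP x))).
rewrite 2!map_mxM !conj_cplx -mulmxBl -mulmxBr -i_cx_of_orthoproj.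
by rewrite -scalemxAr -scalemxAl -!cplxM.
Qed.

(** * Planes of sums of orthogonal structures *)

Lemma sum_mul_sum_diag (R : pzRingType) m n p (I : finType)
    (A : I -> 'M[R]_(m, n)) (B : I -> 'M[R]_(n, p)) :
  (forall i j, i != j -> A i *m B j = 0) ->
  (\sum_i A i) *m (\sum_i B i) = \sum_i A i *m B i.
Proof.
move=> AB; rewrite mulmx_suml; apply: eq_bigr => i _.
rewrite mulmx_sumr (bigD1 i) //= big1 ?addr0 // => j ji.
by rewrite AB // eq_sym.
Qed.

Lemma partial_cx_sum (R : pzRingType) N (I : finType) (A : I -> 'M[R]_N) :
  (forall j, partial_cx (A j)) -> (forall i j, i != j -> A i *m A j = 0) ->
  partial_cx (\sum_j A j).
Proof.
move=> Acx AA; split.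
  rewrite (raddf_sum (@trmx _ _ _)) -sumrN; apply: eq_bigr => j _.
  exact: (proj1 (Acx j)).
rewrite !sum_mul_sum_diag // => [|i j ij]; last by rewrite -mulmxA AA // mulmx0.
by rewrite -sumrN; apply: eq_bigr => j _; exact: (proj2 (Acx j)).
Qed.

Lemma pos_planeZ (R : realType) N (K : 'M[R]_N) c :
  partial_cx K -> 0 < c -> pos_plane (c *: K) = pos_plane K.
Proof.
move=> Kcx c0; apply/vspaceP => v.
exact: etrans (mem_pos_plane _ Kcx c0) (esym (mem_pos_plane1 _ Kcx)).
Qed.

(** The spectral projector is quadratic in the structure, hence additive on
    structures that annihilate each other. *)
Lemma pos_plane_sum (R : realType) N (I : finType) (A : I -> 'M[R]_N) :
  (forall j, partial_cx (A j)) -> (forall i j, i != j -> A i *m A j = 0) ->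
  pos_plane (\sum_j A j) = (\sum_j pos_plane (A j))%VS.
Proof.
move=> Acx AA; have Scx := partial_cx_sum Acx AA.
have cplx_sum (F : I -> 'M[R]_N) : cplx_mx (\sum_j F j) = \sum_j cplx_mx (F j).
  by rewrite /cplx_mx map_mx_sum.
apply/vspaceP => v; apply/idP/idP; last first.
  move=> /memv_sumP[vs hvs ->]; rewrite mem_pos_plane1 // mulmx_sumr; apply/eqP.
  apply: eq_bigr => j _; have := hvs j isT; rewrite mem_pos_plane1 // => /eqP Hu.
  rewrite cplx_sum scaler_sumr mulmx_suml (bigD1 j) //= Hu big1 ?addr0 // => k kj.
  by rewrite -Hu mulmxA -scalemxAl -scalemxAr -cplxM AA // cplx0 !scaler0 mul0mx.
rewrite mem_pos_plane1 // => /eqP /(cx_proj_mem _ Scx) <-.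
have -> : cx_proj (\sum_j A j) = \sum_j cx_proj (A j).
  rewrite /cx_proj -scaler_sumr big_split /= -scaler_sumr -cplx_sum; congr (_ *: (_ + _)).
  rewrite cplx_sum scaler_sumr sum_mul_sum_diag // => i j ij.
  by rewrite -scalemxAl -scalemxAr -cplxM AA // cplx0 !scaler0.
rewrite mulmx_suml; apply: memv_sumr => j _.
by have [_ + _] := cx_proj_orthoproj (Acx j); apply.
Qed.

Lemma partial_cxN (R : pzRingType) N (K : 'M[R]_N) : partial_cx K -> partial_cx (- K).
Proof.
move=> [Ks K3]; split; first by rewrite trmxN Ks.
by rewrite !(mulNmx, mulmxN) opprK K3.
Qed.

Lemma conj_sub_pos_plane (R : realType) N (K : 'M[R]_N) :
  partial_cx K -> conj_sub (pos_plane K) = pos_plane (- K).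
Proof.
move=> Kcx; apply/vspaceP => v; have Ncx := partial_cxN Kcx.
rewrite mem_conj_sub !mem_pos_plane1 // cplxN scalerN -conj_iK.
have -> : map_mx conjc ('i%C *: cplx_mx K) *m v =
    map_mx conjc ('i%C *: cplx_mx K *m map_mx conjc v) by rewrite map_mxM conjmxK.
by rewrite (can2_eq (@conjmxK _ _ _) (@conjmxK _ _ _)).
Qed.

Lemma partial_cx0 (R : pzRingType) N : partial_cx (0 : 'M[R]_N).
Proof. by split; rewrite ?trmx0 ?mulmx0 oppr0. Qed.

Lemma pos_plane0 (R : realType) N : pos_plane (0 : 'M[R]_N) = 0%VS.
Proof.
apply/vspaceP => v; rewrite mem_pos_plane1; last exact: partial_cx0.
by rewrite cplx0 scaler0 mul0mx memv0 eq_sym.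
Qed.

(** Mutually annihilating terms whose sum is the bracket in [component]. *)
Definition signed (R : pzRingType) N r (K : 'I_r -> 'M[R]_N) (l : nat) (j : 'I_r) :=
  if (j < l)%N then - K j else if j == l :> nat then K j else 0.

Lemma componentE (R : pzRingType) N r (K : 'I_r -> 'M[R]_N) l :
  component K l = wt R r l *: \sum_j signed K l j.
Proof.
rewrite /component; congr (_ *: _); rewrite [X in X - _]big_mkcond.
rewrite [X in _ - X]big_mkcond -sumrB; apply: eq_bigr => j _.
by rewrite /signed /=; case: ltngtP => _; rewrite ?subr0 ?sub0r.
Qed.

Lemma signed_family (R : pzRingType) N r (K : 'I_r -> 'M[R]_N) l :
  (forall j, partial_cx (K j)) -> (forall i j, i != j -> K i *m K j = 0) ->
  (forall j, partial_cx (signed K l j)) /\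
  (forall i j, i != j -> signed K l i *m signed K l j = 0).
Proof.
move=> Kcx KK; split=> [j|i j ij]; rewrite /signed.
  by case: ltngtP => _; [exact: partial_cxN|exact: partial_cx0|exact: Kcx].
by do 2 case: ltngtP => _; rewrite ?(mulNmx, mulmxN, mulmx0, mul0mx) ?KK ?oppr0.
Qed.

Lemma pos_plane_component (R : realType) N r (K : 'I_r -> 'M[R]_N) l :
  (forall j, partial_cx (K j)) -> (forall i j, i != j -> K i *m K j = 0) ->
  pos_plane (component K l) =
  (\sum_(j < r | (j < l)%N) conj_sub (pos_plane (K j)) +
   \sum_(j < r | (j : nat) == l) pos_plane (K j))%VS.
Proof.
move=> Kcx KK; have [scx ss] := signed_family l Kcx KK.
rewrite componentE.
rewrite (pos_planeZ (partial_cx_sum scx ss) (wt_gt0 R r l)).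
rewrite pos_plane_sum // [X in (_ = X + _)%VS]big_mkcond.
rewrite [X in (_ = _ + X)%VS]big_mkcond -big_split; apply: eq_bigr => j _.
rewrite /signed /=; case: ltngtP => _.
- by rewrite addv0 conj_sub_pos_plane.
- by rewrite addv0 pos_plane0.
- by rewrite add0v.
Qed.

(** * The base flag *)

Lemma tensmxBl (R : pzRingType) m n p q (A B : 'M[R]_(m, n)) (C : 'M[R]_(p, q)) :
  (A - B) *t C = A *t C - B *t C.
Proof. by apply/matrixP => i j; rewrite !mxE mulrBl. Qed.

Lemma tensmxZl (R : pzRingType) m n p q a (A : 'M[R]_(m, n)) (C : 'M[R]_(p, q)) :
  (a *: A) *t C = a *: (A *t C).
Proof. by apply/matrixP => i j; rewrite !mxE mulrA. Qed.

Lemma tensmxNr (R : pzRingType) m n p q (A : 'M[R]_(m, n)) (C : 'M[R]_(p, q)) :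
  A *t (- C) = - (A *t C).
Proof. by apply/matrixP => i j; rewrite !mxE mulrN. Qed.

Lemma tr_tensmx (R : pzRingType) m n (A : 'M[R]_m) (B : 'M[R]_n) :
  \tr (A *t B) = \tr A * \tr B.
Proof. by rewrite /mxtrace mulr_sum; apply: eq_bigr => i _; rewrite mxE. Qed.

Lemma trmx_J2 (R : realType) : (J2 R)^T = - J2 R.
Proof.
apply/matrixP => i j; rewrite !mxE.
by case: ltngtP => _; rewrite ?oppr0 ?opprK.
Qed.

Lemma J2_sqr (R : realType) : J2 R *m J2 R = - 1%:M.
Proof.
apply/matrixP => i j; rewrite !mxE !big_ord_recl big_ord0 !mxE /=.
case: i => [[|[|//]] hi]; case: j => [[|[|//]] hj] /=;
  rewrite ?mulr0 ?mul0r ?mulr1 ?mul1r ?mulrN1 ?mulN1r; lra.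
Qed.

Lemma psumS r (ns : 'I_r -> nat) (j : 'I_r) :
  psum ns j.+1 = (psum ns j + ns j)%N.
Proof.
rewrite /psum (bigD1 j) //= addnC; congr (_ + _)%N; apply: eq_bigl => i.
by rewrite ltnS [RHS]ltn_neqAle andbC -val_eqE.
Qed.

Lemma psum_mono r (ns : 'I_r -> nat) : {homo psum ns : k l / (k <= l)%N}.
Proof.
move=> k l kl; rewrite /psum [X in (X <= _)%N]big_mkcond.
rewrite [X in (_ <= X)%N]big_mkcond; apply: leq_sum => j _.
by case: ifP => // jk; rewrite (leq_trans jk).
Qed.

Lemma psum_r r (ns : 'I_r -> nat) : psum ns r = \sum_j ns j.
Proof. by rewrite /psum; apply: eq_bigl => j; rewrite ltn_ord. Qed.

Definition initial_proj (R : realType) n (k : nat) : 'M[R]_n :=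
  diag_mx (\row_(i < n) (i < k)%N%:R).
Arguments initial_proj R n k : clear implicits.

Lemma initial_proj_mul (R : realType) n k l :
  initial_proj R n k *m initial_proj R n l = initial_proj R n (minn k l).
Proof.
rewrite /initial_proj mulmx_diag; congr diag_mx; apply/rowP => i; rewrite !mxE.
by rewrite -natrM mulnb ltn_min.
Qed.

Lemma tr_initial_proj (R : realType) n k : (k <= n)%N ->
  \tr (initial_proj R n k) = k%:R.
Proof.
move=> kn; rewrite mxtrace_diag.
under eq_bigr do rewrite mxE.
rewrite -natr_sum -(big_mkord predT (fun i => (i < k)%N : nat)); congr _%:R.
rewrite (big_cat_nat _ kn) //= (eq_big_nat _ _ (F2 := fun=> 1%N)) => [|i /andP[_ ->]] //.
rewrite sum_nat_const_nat subn0 muln1 big_nat_cond big1 ?addn0 // => i.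
by rewrite andbT => /andP[ki _]; rewrite ltnNge ki.
Qed.

Section block.
Context {R : realType} {n r : nat} (ns : 'I_r -> nat).
Notation E := (block_J R n ns).
Notation D k := (initial_proj R n (psum ns k)).

Lemma psum_le k : (\sum_(j < r) ns j <= n)%N -> (psum ns k <= n)%N.
Proof.
move=> hm; apply: leq_trans hm; rewrite /psum [X in (X <= _)%N]big_mkcond.
by apply: leq_sum => j _; case: ifP.
Qed.

Lemma block_JE (j : 'I_r) : E j = (D j.+1 - D j) *t J2 R.
Proof.
rewrite /block_J; congr (_ *t _); apply/matrixP => a b; rewrite !mxE -mulrnBl.
congr (_ *+ _); have h := psum_mono ns (leqnSn j); rewrite leqNgt.
by case: (ltnP a (psum ns j)) => h1; case: (ltnP a (psum ns j.+1)) => h2 /=;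
  rewrite ?subrr ?subr0 //; lia.
Qed.

Lemma block_J_sqr (j : 'I_r) : E j *m E j = - ((D j.+1 - D j) *t 1%:M).
Proof.
rewrite block_JE tensmx_mul J2_sqr tensmxNr mulmxBl !mulmxBr !initial_proj_mul.
have h := psum_mono ns (leqnSn j).
by rewrite !minnn (minn_idPr h) (minn_idPl h) subrr subr0.
Qed.

Lemma block_J_partial_cx (j : 'I_r) : partial_cx (E j).
Proof.
split.
  by rewrite block_JE trmx_tens trmx_J2 tensmxNr trmxD trmxN !tr_diag_mx.
rewrite block_J_sqr mulNmx block_JE tensmx_mul mul1mx; congr (- (_ *t _)).
have h := psum_mono ns (leqnSn j).
rewrite mulmxBl !mulmxBr !initial_proj_mul.
by rewrite !minnn (minn_idPr h) (minn_idPl h) subrr subr0.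
Qed.

Lemma block_J_mul (i j : 'I_r) : i != j -> E i *m E j = 0.
Proof.
wlog ij : i j / (i < j)%N => [hwlog|_].
  move=> ij; have := ij; rewrite -val_eqE neq_ltn => /orP[lt|lt]; first exact: hwlog.
  apply: partial_cx_mul0 (hwlog _ _ lt _); last by rewrite eq_sym.
    exact: (proj1 (block_J_partial_cx j)).
  exact: (proj1 (block_J_partial_cx i)).
rewrite !block_JE tensmx_mul.
suff -> : (D i.+1 - D i) *m (D j.+1 - D j) = 0 :> 'M[R]_n by rewrite tens0mx.
have mono : forall a b, (a <= b)%N -> minn (psum ns a) (psum ns b) = psum ns a.
  by move=> a b ab; apply/minn_idPl/psum_mono.
rewrite mulmxBl !mulmxBr !initial_proj_mul !mono ?subrr //; lia.
Qed.

Lemma tr_block_J_sqr (j : 'I_r) : (\sum_(j < r) ns j <= n)%N ->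
  \tr (E j *m E j) = - (2 * (ns j)%:R).
Proof.
move=> hm; rewrite block_J_sqr mxtraceN tr_tensmx mxtrace1 mxtraceD mxtraceN.
rewrite !tr_initial_proj ?psum_le // psumS natrD addrAC subrr add0r.
by rewrite mulrC.
Qed.

Lemma sum_block_J l : (l <= r)%N ->
  \sum_(j < r | (j < l)%N) E j = D l *t J2 R.
Proof.
elim: l => [_|l IH lr].
  rewrite big_pred0 //; have -> : D 0%N = 0 :> 'M[R]_n.
    apply/matrixP => a b; rewrite !mxE /psum big_pred0 //= mul0rn //.
  by rewrite tens0mx.
rewrite (bigD1 (Ordinal lr)) //= block_JE /=.
have -> : \sum_(i < r | (i < l.+1)%N && (i != Ordinal lr)) E i = D l *t J2 R.
  rewrite -IH ?(ltnW lr) //; apply: eq_bigl => i.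
  by rewrite ltnS [RHS]ltn_neqAle andbC -val_eqE.
by rewrite tensmxBl subrK.
Qed.

Lemma LambdaE l : (l <= r)%N -> Lambda R n ns l = component E l.
Proof.
move=> lr; rewrite /Lambda /Upsilon /component /wt sum_block_J //.
case: ifP => [lr'|/negbT]; last first.
  rewrite -leqNgt => rl; have -> : l = r by lia.
  rewrite big_pred0 => [|j]; last by rewrite ltn_eqF.
  rewrite sub0r scale1r.
  apply/matrixP => a b; rewrite !mxE -mulNr; congr (_ * _).
  by case: eqP => _; case: ltnP => _; rewrite ?mulr0n ?mulr1n ?oppr0.
rewrite tensmxZl (big_pred1 (Ordinal lr')) => [|j]; last by [].
rewrite block_JE -tensmxBl; congr (_ *: (_ *t _)) => /=.
apply/matrixP => a b; rewrite !mxE -!mulrnBl; congr (_ *+ _).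
have := psum_mono ns (leqnSn l).
by case: ltnP => h1; case: ltnP => h2; rewrite ?subrr ?subr0 ?sub0r //; lia.
Qed.

Lemma sum_block_J_sqr : psum ns r = n ->
  (\sum_j E j) *m (\sum_j E j) = - 1%:M.
Proof.
move=> mn.
have -> : \sum_j E j = \sum_(j < r | (j < r)%N) E j.
  by apply: eq_bigl => j; rewrite ltn_ord.
rewrite sum_block_J // mn tensmx_mul J2_sqr tensmxNr initial_proj_mul minnn.
have -> : initial_proj R n n = 1%:M.
  by apply/matrixP => a b; rewrite !mxE ltn_ord.
congr (- _); apply/matrixP => a b.
case: (mxtens_indexP a) => a1 a2; case: (mxtens_indexP b) => b1 b2.
rewrite tensmxE !mxE (inj_eq (can_inj (@mxtens_indexK _ _))) xpair_eqE.
by rewrite -natrM mulnb.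
Qed.

(** If [m < n] the blocks do not meet the last coordinate, whose sign can then
    be changed freely. *)
Lemma block_J_reflection : (psum ns r < n)%N ->
  exists s : 'M[R]_(n * 2), [/\ s^T *m s = 1%:M, \det s = -1 &
    forall j, s *m E j = E j /\ E j *m s = E j].
Proof.
move=> mn.
have ln : (n.-1 < n)%N by lia.
pose o := mxtens_index (Ordinal ln, 0 : 'I_2).
pose d : 'rV[R]_(n * 2) := \row_k (if k == o then -1 else 1).
exists (diag_mx d); split.
- rewrite tr_diag_mx mulmx_diag -diag_const_mx; congr diag_mx.
  by apply/rowP => k; rewrite !mxE; case: eqP => _; rewrite ?mulrNN mulr1.
- rewrite det_diag (bigD1 o) //= mxE eqxx big1 ?mulr1 // => k /negPf ko.
  by rewrite mxE ko.
move=> j; rewrite block_JE.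
have hj : (psum ns j.+1 <= n.-1)%N by have := psum_mono ns (ltn_ord j); lia.
have h2 := psum_mono ns (leqnSn j).
have D0 a b : a = Ordinal ln \/ b = Ordinal ln -> (D j.+1 - D j) a b = 0 :> R.
  rewrite !mxE; case: eqVneq => [<-|_]; last by rewrite !mulr0n subrr.
  move=> aE; have {aE} -> : a = Ordinal ln by case: aE.
  rewrite !mulr1n /= (leq_gtF hj) (leq_gtF (leq_trans h2 hj)).
  by rewrite subrr.
have E0 a b : a = o \/ b = o -> ((D j.+1 - D j) *t J2 R) a b = 0.
  move=> ab; rewrite [LHS]mxE D0 ?mul0r //.
  by case: ab => ->; rewrite mxtens_indexK; [left|right].
split; apply/matrixP => a b.
- rewrite mul_diag_mx [LHS]mxE [X in X * _]mxE.
  case: (eqVneq a o) => [ao|_]; last exact: mul1r.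
  by rewrite E0 ?mulr0 //; left.
- rewrite mul_mx_diag [LHS]mxE [X in _ * X]mxE.
  case: (eqVneq b o) => [bo|_]; last exact: mulr1.
  by rewrite E0 ?mul0r //; right.
Qed.
End block.

(** * Calculus on matrices *)

Section matrix_calculus.
Context {R : realType} {V : normedModType R}.

Lemma is_derive_mx m n (M : V -> 'M[R]_(m, n)) x v (D : 'M[R]_(m, n)) :
  (forall i j, is_derive x v (fun t => M t i j) (D i j)) -> is_derive x v M D.
Proof.
move=> dM; have Mder : derivable M x v by apply/derivable_mxP.
apply: DeriveDef => //; rewrite derive_mx //; apply/matrixP => i j.
by rewrite mxE derive_val.
Qed.

Lemma is_derive_coord m n (M : V -> 'M[R]_(m, n)) x v (D : 'M[R]_(m, n)) i j :
  is_derive x v M D -> is_derive x v (fun t => M t i j) (D i j).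
Proof.
move=> dM; have Mder : derivable M x v by [].
apply: DeriveDef; first exact: (derivable_mxP _ _ _).1.
have := derive_mx Mder; rewrite (@derive_val _ _ _ _ _ _ _ dM) => ->.
by rewrite mxE.
Qed.

Lemma is_derive_trmx m n (M : V -> 'M[R]_(m, n)) x v D :
  is_derive x v M D -> is_derive x v (fun t => (M t)^T) D^T.
Proof.
move=> dM; apply: is_derive_mx => i j; rewrite mxE.
have -> : (fun t => (M t)^T i j) = (fun t => M t j i) by apply/funext => t; rewrite mxE.
exact: is_derive_coord.
Qed.

Lemma is_derive_mulmx m n p (M : V -> 'M[R]_(m, n)) (N : V -> 'M[R]_(n, p)) x v dM dN :
  is_derive x v M dM -> is_derive x v N dN ->
  is_derive x v (fun t => M t *m N t) (dM *m N x + M x *m dN).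
Proof.
move=> hM hN; apply: is_derive_mx => i j.
have -> : (fun t => (M t *m N t) i j) =
    \sum_(k < n) ((fun t => M t i k) * (fun t => N t k j) : V -> R).
  by apply/funext => t; rewrite mxE fct_sumE.
rewrite !mxE -big_split /=.
apply: is_derive_sum => k; apply: is_derive_eq.
  by apply: is_deriveM; apply: is_derive_coord; eassumption.
by rewrite addrC; congr (_ + _); exact: mulrC.
Qed.

Lemma differentiable_mx m n (M : V -> 'M[R]_(m, n)) x :
  (forall i j, differentiable (fun t => M t i j) x) -> differentiable M x.
Proof.
move=> dM.
have -> : M = \sum_(i < m) \sum_(j < n) (fun t => M t i j *: delta_mx i j).
  apply/funext => t; rewrite [LHS]matrix_sum_delta fct_sumE.
  by apply: eq_bigr => i _; rewrite fct_sumE.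
by apply: differentiable_sum => i; apply: differentiable_sum => j;
  apply: differentiableZl.
Qed.

Lemma differentiable_entry m n (M : V -> 'M[R]_(m, n)) x i j :
  differentiable M x -> differentiable (fun t => M t i j) x.
Proof.
move=> dM; apply: (@differentiable_comp _ _ _ _ M (fun N : 'M[R]_(m, n) => N i j)) => //.
exact: differentiable_coord.
Qed.

Lemma differentiable_trmx m n (M : V -> 'M[R]_(m, n)) x :
  differentiable M x -> differentiable (fun t => (M t)^T) x.
Proof.
move=> dM; apply: differentiable_mx => i j.
have -> : (fun t => (M t)^T i j) = (fun t => M t j i) by apply/funext => t; rewrite mxE.
exact: differentiable_entry.
Qed.

Lemma differentiable_mulmx m n p (M : V -> 'M[R]_(m, n)) (N : V -> 'M[R]_(n, p)) x :
  differentiable M x -> differentiable N x ->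
  differentiable (fun t => M t *m N t) x.
Proof.
move=> dM dN; apply: differentiable_mx => i j.
have -> : (fun t => (M t *m N t) i j) =
    \sum_(k < n) ((fun t => M t i k) * (fun t => N t k j) : V -> R).
  by apply/funext => t; rewrite mxE fct_sumE.
by apply: differentiable_sum => k; apply: differentiableM; apply: differentiable_entry.
Qed.

Lemma Ck_on_cst (W : normedModType R) k (a : W) : Ck_on k setT (fun _ : V => a).
Proof.
elim: k a => [|k IH] a /=; first by move=> x _; exact: cvg_cst.
split=> [x _|v]; first exact: differentiable_cst.
have -> : (fun x => 'D_v (fun=> a) x) = (fun=> 0 : W).
  by apply/funext => x; exact: derive_cst.
exact: IH.
Qed.

(** For a function whose derivatives are known everywhere to be smooth; two
    such steps lead from a quadratic map to a constant. *)
Lemma Ck_on_step (W : normedModType R) k (f : V -> W) (df : V -> V -> W) :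
  (forall x, differentiable f x) -> (forall x v, is_derive x v f (df v x)) ->
  (forall j v, Ck_on j setT (df v)) -> Ck_on k setT f.
Proof.
move=> fd fD dfC; case: k => [|k] /=.
  by move=> x _; exact: differentiable_continuous.
split=> [x _|v]; first exact: fd.
have -> : (fun x => 'D_v f x) = df v by apply/funext => x; rewrite derive_val.
exact: dfC.
Qed.

End matrix_calculus.

Lemma Ck_on_conjugation (R : realType) N (L : 'M[R]_N) k :
  Ck_on k setT (fun g : 'M[R]_N => g *m L *m g^T).
Proof.
have did (x : 'M[R]_N) : differentiable (fun g : 'M[R]_N => g) x.
  exact: ex_diff.
have Did (x v : 'M[R]_N) : is_derive x v (fun g : 'M[R]_N => g) v.
  exact: is_derive_id.
have dc (x A : 'M[R]_N) : differentiable (fun g : 'M[R]_N => A) x.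
  exact: differentiable_cst.
have Dc (x v A : 'M[R]_N) : is_derive x v (fun g : 'M[R]_N => A) 0.
  exact: is_derive_cst.
apply: (@Ck_on_step _ _ _ k _ (fun v g => v *m L *m g^T + g *m L *m v^T)).
- move=> x; apply: differentiable_mulmx; last exact: differentiable_trmx.
  exact: differentiable_mulmx.
- move=> x v; apply: is_derive_eq.
    apply: is_derive_mulmx; last exact: is_derive_trmx.
    exact: is_derive_mulmx.
  by rewrite mulmx0 addr0.
move=> j v.
apply: (@Ck_on_step _ _ _ j _ (fun w _ => v *m L *m w^T + w *m L *m v^T)).
- move=> x; apply: differentiableD; apply: differentiable_mulmx => //.
    exact: differentiable_trmx.
  exact: differentiable_mulmx.
- move=> x w; apply: is_derive_eq.
    apply: is_deriveD; apply: is_derive_mulmx => //.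
      exact: is_derive_trmx.
    exact: is_derive_mulmx.
  by rewrite !mul0mx !mulmx0 !addr0 add0r.
by move=> i w; exact: Ck_on_cst.
Qed.

Lemma continuous_conjugation (R : realType) N (L : 'M[R]_N) :
  continuous (fun g : 'M[R]_N => g *m L *m g^T).
Proof. by have := Ck_on_conjugation L 0 => /= h x; exact: h. Qed.

Lemma is_derive_conjugation (R : realType) N (c : R -> 'M[R]_N) X A :
  SO_curve c X -> is_derive (0 : R) (1 : R) (fun t => c t *m A *m (c t)^T)
    (X *m A + A *m X^T).
Proof.
move=> [_ c0 dc]; apply: is_derive_eq.
  apply: is_derive_mulmx; last exact: is_derive_trmx.
  exact: is_derive_mulmx.
by rewrite !c0 mulmx0 addr0 trmx1 mulmx1 mul1mx.
Qed.

(** Differentiate [c t *m (c t)^T = 1]. *)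
Lemma SO_curve_so (R : realType) N (c : R -> 'M[R]_N) X :
  SO_curve c X -> X^T = - X.
Proof.
move=> cX; have [cSO _ _] := cX.
have := is_derive_conjugation 1%:M cX.
have -> : (fun t => c t *m 1%:M *m (c t)^T) = cst 1%:M.
  by apply/funext => t; rewrite mulmx1 (mulmx1C (proj1 (cSO t))).
move=> h; have := @derive_val _ _ _ _ _ _ _ h; rewrite derive_cst mulmx1 mul1mx.
by move=> /esym/eqP; rewrite addrC addr_eq0 => /eqP.
Qed.

Lemma continuous_det (R : realType) N : continuous (fun g : 'M[R]_N => \det g).
Proof.
rewrite /determinant; apply: continuous_big => [|s _]; first exact: add_continuous.
have cs : continuous (fun g : 'M[R]_N => \prod_i g i (s i)).
  apply: continuous_big => [|i _]; first exact: mul_continuous.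
  exact: coord_continuous.
move=> g; apply: (@continuousM R _ (fun=> (-1) ^+ s)); last exact: cs.
exact: cst_continuous.
Qed.

Lemma closed_SO (R : realType) N : closed (SO R N).
Proof.
have -> : SO R N = (fun g : 'M[R]_N => g^T *m g) @^-1` [set 1%:M] `&`
    (fun g : 'M[R]_N => \det g) @^-1` [set 1].
  by [].
apply: closedI.
  apply: (continuous_closedP _).1; last first.
    exact/accessible_closed_set1/hausdorff_accessible/norm_hausdorff.
  move=> g; apply: differentiable_continuous; apply: differentiable_mulmx.
    apply: differentiable_trmx; exact: ex_diff.
  exact: ex_diff.
apply: (continuous_closedP _).1; first exact: continuous_det.
exact/accessible_closed_set1/hausdorff_accessible/norm_hausdorff.
Qed.

Lemma compact_unit_box (R : realType) m n :
  compact [set A : 'M[R]_(m, n) | forall i j, `|A i j| <= 1].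
Proof.
pose B := [set v : 'rV[R]_(m * n) | forall k, `[(-1 : R), 1]%classic (v 0 k)].
have cB : compact B.
  apply: (@rV_compact R (m * n) (fun=> `[(-1 : R), 1]%classic)) => k.
  exact: segment_compact.
have -> : [set A : 'M[R]_(m, n) | forall i j, `|A i j| <= 1] = (@vec_mx R m n) @` B.
  apply/seteqP; split=> [A hA|_ [v hv <-] i j] /=; last first.
    by rewrite mxE ler_norml; have := hv (mxvec_index i j); rewrite /= in_itv.
  exists (mxvec A); last exact: mxvecK.
  by move=> k /=; case/mxvec_indexP: k => i j; rewrite mxvecE in_itv /= -ler_norml.
apply: continuous_compact cB; apply: continuous_subspaceT => v.
apply: differentiable_continuous; apply: differentiable_mx => i j.
have -> : (fun t : 'rV[R]_(m * n) => vec_mx t i j) = (fun t => t 0 (mxvec_index i j)).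
  by apply/funext => t; rewrite mxE.
exact: differentiable_coord.
Qed.

Lemma compact_SO (R : realType) N : compact (SO R N).
Proof.
apply: (subclosed_compact (@closed_SO R N) (@compact_unit_box R N N)).
move=> g [gg _] i j /=.
have : (g^T *m g) j j = 1 by rewrite gg mxE eqxx.
rewrite mxE (bigD1 i) //= mxE -expr2 => h.
rewrite -(@expr_le1 _ 2) // real_normK ?num_real // -h lerDl.
by apply: sumr_ge0 => k _; rewrite mxE -expr2 sqr_ge0.
Qed.

Lemma continuous_orbit_map (R : realType) N (I : eqType) (L : I -> 'M[R]_N) :
  continuous ((fun g (l : I) => g *m L l *m g^T)
    : 'M[R]_N -> prod_topology (fun _ : I => 'M[R]_N)).
Proof.
move=> g.
have FF : Filter ((fun (x : 'M[R]_N) (l : I) => x *m L l *m x^T) @ nbhs g).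
  exact: fmap_filter.
apply/(@cvg_sup _ _ _ _ _ FF) => l.
move=> U /= [B [[W oW <-]] /= WL sub].
apply: filterS (sub) _.
apply: (continuous_conjugation (L := L l) (x := g)).
exact: open_nbhs_nbhs.
Qed.

(** The image of a compact set, in a Hausdorff space. *)
Lemma closed_orbit_image (R : realType) N (I : eqType) (L : I -> 'M[R]_N)
    (V : set 'M[R]_N) : open V ->
  closed ((fun g (l : I) => g *m L l *m g^T) @` (SO R N `&` ~` V)
    : set (prod_topology (fun _ : I => 'M[R]_N))).
Proof.
move=> oV; apply: compact_closed.
  by apply: hausdorff_product => l; exact: norm_hausdorff.
apply: continuous_compact; last first.
  apply: (subclosed_compact _ (@compact_SO R N)); last exact: subIsetl.
  by apply: closedI; [exact: closed_SO|exact: open_closedC].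
by apply: continuous_subspaceT; exact: continuous_orbit_map.
Qed.

(** * Triangular combinations and conjugacy in SO(2n) *)

Lemma component_mulmx (R : comPzRingType) N r (A B : 'M[R]_N) (K : 'I_r -> 'M[R]_N) l :
  component (fun j => A *m K j *m B) l = A *m component K l *m B.
Proof.
rewrite /component -scalemxAr -scalemxAl mulmxBr mulmxBl !mulmx_sumr !mulmx_suml.
by [].
Qed.

Lemma componentB (R : pzRingType) N r (K L : 'I_r -> 'M[R]_N) l :
  component (fun j => K j - L j) l = component K l - component L l.
Proof.
rewrite /component -scalerBr !sumrB; congr (_ *: _).
by rewrite !opprD !opprK addrACA.
Qed.

(** The system is triangular with nonzero diagonal entries. *)
Lemma component_eq0 (R : numFieldType) N r (K : 'I_r -> 'M[R]_N) :
  (forall l : 'I_r, component K l = 0) -> forall j, K j = 0.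
Proof.
move=> K0 j; have [k] := ubnP (j : nat); elim: k j => // k IH j; rewrite ltnS => jk.
have /eqP := K0 j; rewrite /component scaler_eq0 gt_eqF ?wt_gt0 //=.
rewrite (big_pred1 j) => [|i]; last by [].
by rewrite big1 ?subr0 => [/eqP //|i ij]; apply: IH; exact: leq_trans ij jk.
Qed.

Lemma component_inj (R : numFieldType) N r (K L : 'I_r -> 'M[R]_N) :
  (forall l : 'I_r, component K l = component L l) -> K = L.
Proof.
move=> KL; apply/funext => j; apply/eqP; rewrite -subr_eq0; apply/eqP; move: j.
by apply: component_eq0 => l; rewrite componentB KL subrr.
Qed.

(** The coefficient of [K j] is the weight of [j] minus the sum of the later
    weights. *)
Lemma sum_component (R : comPzRingType) N r (K : 'I_r -> 'M[R]_N) :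
  \sum_(l < r.+1) component K l = 0.
Proof.
pose e l j : R := if (j < l)%N then -1 else if j == l :> nat then 1 else 0.
have -> : \sum_(l < r.+1) component K l =
    \sum_(j < r) (\sum_(l < r.+1) wt R r l * e l j) *: K j.
  under [RHS]eq_bigr do rewrite scaler_suml.
  rewrite exchange_big /=; apply: eq_bigr => l _.
  rewrite componentE scaler_sumr; apply: eq_bigr => j _; rewrite -scalerA /signed /e.
  by case: ltngtP => _; rewrite ?scaleN1r ?scale0r ?scale1r.
apply: big1 => j _; rewrite (bigD1 (widen_ord (leqnSn r) j)) //=.
suff -> : \sum_(l < r.+1 | l != widen_ord (leqnSn r) j) wt R r l * e l j =
    - wt R r j by rewrite /e ltnn eqxx mulr1 subrr scale0r.
rewrite [RHS](_ : _ = - \sum_(l < r.+1 | (j.+1 <= l)%N) wt R r l); last first.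
  by rewrite sum_wt // /wt ltn_ord.
rewrite -sumrN [RHS]big_mkcond [LHS]big_mkcond; apply: eq_bigr => l _.
rewrite -val_eqE /e /=; case: ltngtP => _ //=; by rewrite ?mulr0 ?mulrN1.
Qed.

Lemma partial_cx_conj (R : comPzRingType) N (g K : 'M[R]_N) :
  g^T *m g = 1%:M -> partial_cx K -> partial_cx (g *m K *m g^T).
Proof.
move=> gg [Ks K3]; split.
  by rewrite !trmx_mul trmxK Ks mulNmx mulmxN mulmxA.
have -> : g *m K *m g^T *m (g *m K *m g^T) = g *m (K *m K) *m g^T.
  by rewrite -!mulmxA (mulmxA g^T g) gg mul1mx.
have -> : g *m (K *m K) *m g^T *m (g *m K *m g^T) = g *m (K *m K *m K) *m g^T.
  by rewrite -!mulmxA (mulmxA g^T g) gg mul1mx.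
by rewrite K3 mulmxN mulNmx.
Qed.

(** Extensionality with the vectors typed as matrices, the form in which the
    membership lemmas above are stated. *)
Lemma eq_vspace_cV (F : fieldType) N (x y : {vspace 'cV[F]_N}) :
  (forall v : 'cV_N, (v \in x) = (v \in y)) -> x = y.
Proof. by move=> xy; apply/vspaceP. Qed.

Lemma sub_vspace_cV (F : fieldType) N (x y : {vspace 'cV[F]_N}) :
  (forall v : 'cV_N, v \in x -> v \in y) -> (x <= y)%VS.
Proof. by move=> xy; apply/subvP. Qed.

Lemma image_pos_plane (R : realType) N (g K : 'M[R]_N) :
  g^T *m g = 1%:M -> partial_cx K ->
  image_sub g (pos_plane K) = pos_plane (g *m K *m g^T).
Proof.
move=> gg Kcx; have Lcx := partial_cx_conj gg Kcx; have gg' := mulmx1C gg.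
apply: eq_vspace_cV => v.
rewrite (mem_image_sub _ _ gg) (mem_pos_plane1 _ Kcx) (mem_pos_plane1 _ Lcx).
have -> : 'i%C *: cplx_mx (g *m K *m g^T) *m v =
    cplx_mx g *m ('i%C *: cplx_mx K *m (cplx_mx g^T *m v)).
  by rewrite !cplxM -!scalemxAl -!scalemxAr !mulmxA.
apply/eqP/eqP => [->|/(congr1 (mulmx (cplx_mx g^T)))].
  by rewrite mulmxA -cplxM gg' cplx1 mul1mx.
by rewrite mulmxA -cplxM gg cplx1 mul1mx.
Qed.

Lemma det_orthogonal (R : realDomainType) N (g : 'M[R]_N) :
  g^T *m g = 1%:M -> \det g = 1 \/ \det g = -1.
Proof.
move=> /(congr1 determinant); rewrite det_mulmx det_tr det1 -expr2 => /eqP.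
by rewrite sqrf_eq1 => /orP[] /eqP ->; [left|right].
Qed.

(** [simultaneous_conj] gives an orthogonal conjugating matrix, which has to be
    made special. If [m < n], a reflection commuting with the blocks corrects
    the determinant. If [m = n], the blocks add up to a complex structure [J]
    with which [h^T *m g] commutes, and [det_commuting_cx_ge0] shows that [g]
    has the determinant of [h]. *)
Lemma SO_conj (R : realType) n r (ns : 'I_r -> nat) (K : 'I_r -> 'M[R]_(n * 2)) :
  (\sum_(j < r) ns j <= n)%N ->
  (forall j, partial_cx (K j)) -> (forall i j, i != j -> K i *m K j = 0) ->
  (forall j, \tr (K j *m K j) = - (2 * (ns j)%:R)) ->
  (psum ns r = n -> exists2 h, SO R (n * 2) h &
     \sum_j K j = h *m (\sum_j block_J R n ns j) *m h^T) ->
  exists2 g, SO R (n * 2) g & forall j, K j = g *m block_J R n ns j *m g^T.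
Proof.
move=> hm Kcx KK trK Kn.
have [||j|g gg gE] := @simultaneous_conj R _ _ (block_J R n ns) K _ _ Kcx KK.
- exact: block_J_partial_cx.
- exact: block_J_mul.
- by rewrite trK tr_block_J_sqr.
have gg' := mulmx1C gg.
have KE j : K j = g *m block_J R n ns j *m g^T.
  by rewrite gE -mulmxA gg' mulmx1.
have [g1|gN1] := det_orthogonal gg; first by exists g.
have [mn|mn] := eqVneq (psum ns r) n; last first.
  have mn' : (psum ns r < n)%N by rewrite ltn_neqAle mn psum_r.
  have [s [ss dets sE]] := block_J_reflection (R := R) mn'.
  exists (g *m s); first split.
  - by rewrite trmx_mul -mulmxA (mulmxA g^T) gg mul1mx ss.
  - by rewrite det_mulmx gN1 dets mulrNN mulr1.
  move=> j; have [sEj _] := sE j.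
  have Est : block_J R n ns j *m s^T = block_J R n ns j.
    have := congr1 trmx sEj; rewrite trmx_mul.
    by rewrite (proj1 (block_J_partial_cx ns j)) mulNmx => /oppr_inj.
  by rewrite trmx_mul !mulmxA -(mulmxA g s) sEj -(mulmxA g _ s^T) Est.
have [h [hh h1] hE] := Kn mn.
have hh' := mulmx1C hh.
have JJ := sum_block_J_sqr (R := R) mn; set J := \sum_j block_J R n ns j in hE JJ.
have gJ : \sum_j K j = g *m J *m g^T.
  by rewrite /J mulmx_sumr mulmx_suml; apply: eq_bigr => j _; exact: KE.
have comm : h^T *m g *m J = J *m (h^T *m g).
  have : h^T *m (h *m J *m h^T) *m g = h^T *m (g *m J *m g^T) *m g.
    by rewrite -hE -gJ.
  by rewrite !mulmxA hh mul1mx -[in RHS](mulmxA _ g^T g) gg mulmx1 => <-.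
have := det_commuting_cx_ge0 JJ comm.
by rewrite det_mulmx det_tr h1 gN1 mul1r oppr_ge0 ler10.
Qed.

(** * The embedding *)

(** The conjugate [g *m Lambda l *m g^T] at [flag_act g base], in a form that
    does not depend on a choice of [g]. *)
Definition flag_map (R : realType) (n r : nat) (x : flag R n r) (l : 'I_r.+1) :
    'M[R]_(n * 2) :=
  component (fun j => cx_of (x j)) l.

Lemma tr_component_sqr (R : comPzRingType) N r (K : 'I_r -> 'M[R]_N) l :
  (forall j, partial_cx (K j)) -> (forall i j, i != j -> K i *m K j = 0) ->
  \tr (component K l *m component K l) =
    wt R r l ^+ 2 * \sum_(j < r | (j <= l)%N) \tr (K j *m K j).
Proof.
move=> Kcx KK; have [_ ss] := signed_family l Kcx KK.
rewrite componentE -scalemxAl -scalemxAr scalerA mxtraceZ sum_mul_sum_diag //.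
rewrite (raddf_sum (@mxtrace _ _)) [in RHS]big_mkcond expr2; congr (_ * _).
apply: eq_bigr => j _; rewrite /signed.
by case: ltngtP => _; rewrite ?mulNmx ?mulmxN ?opprK ?mulmx0 //; exact: mxtrace0.
Qed.

Section flag_map_facts.
Context {R : realType} {n r : nat} {ns : 'I_r -> nat}.
Hypothesis hm : (\sum_(j < r) ns j <= n)%N.
Implicit Types (x : flag R n r) (g : 'M[R]_(n * 2)).
Notation E := (block_J R n ns).
Notation M := (flag_manifold R n ns).
Notation base := (base_flag R n ns).

Lemma flag_map_act g x l : g^T *m g = 1%:M ->
  flag_map (flag_act g x) l = g *m flag_map x l *m g^T.
Proof.
move=> gg; rewrite /flag_map -component_mulmx; congr (component _ l).
by apply/funext => j; rewrite /flag_act cx_of_image.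
Qed.

Lemma flag_map_base (l : 'I_r.+1) : flag_map base l = Lambda R n ns l.
Proof.
rewrite LambdaE ?leq_ord //; congr (component _ l); apply/funext => j.
exact/cx_of_pos_plane/block_J_partial_cx.
Qed.

Lemma flag_map_act_base g (l : 'I_r.+1) : g^T *m g = 1%:M ->
  flag_map (flag_act g base) l = g *m Lambda R n ns l *m g^T.
Proof. by move=> gg; rewrite flag_map_act // flag_map_base. Qed.

Lemma flag_act_baseE g : g^T *m g = 1%:M ->
  flag_act g base = (fun j => pos_plane (g *m E j *m g^T)).
Proof.
move=> gg; apply/funext => j; rewrite /flag_act /base_flag image_pos_plane //.
exact: block_J_partial_cx.
Qed.

Lemma flag_isotropic_sub x : M x -> forall j, isotropic_sub (x j).
Proof.
move=> [_ _ iso _] j u v uj vj.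
have sub w : w \in x j -> w \in (\sum_(j < r) x j)%VS.
  by apply/subvP; rewrite (bigD1 j) //= addvSl.
by apply: iso; [exact: sub uj|exact: sub vj].
Qed.

Lemma flag_partial_cx x : M x -> forall j, partial_cx (cx_of (x j)).
Proof. by move=> Mx j; apply/partial_cx_of/flag_isotropic_sub. Qed.

Lemma flag_cx_mul0 x : M x -> forall i j, i != j -> cx_of (x i) *m cx_of (x j) = 0.
Proof. by move=> [_ ortho iso _]; apply: cx_of_mul0. Qed.

Lemma flag_act_base_mem g : SO R (n * 2) g -> M (flag_act g base).
Proof.
move=> gSO; have gg := proj1 gSO.
have Kcx j : partial_cx (g *m E j *m g^T).
  exact/partial_cx_conj/block_J_partial_cx.
have KK i j : i != j -> g *m E i *m g^T *m (g *m E j *m g^T) = 0.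
  move=> ij; rewrite -!mulmxA (mulmxA g^T g) gg mul1mx (mulmxA (E i)) block_J_mul //.
  by rewrite mul0mx mulmx0.
rewrite flag_act_baseE //; split.
- move=> j; apply: dim_pos_plane => //.
  rewrite -!mulmxA (mulmxA g^T g) gg mul1mx mxtrace_mulC -!mulmxA gg mulmx1.
  exact: tr_block_J_sqr.
- by move=> j k jk; apply: orthogonal_pos_plane => //; exact: KK.
- exact: isotropic_sum_pos_plane.
- by move=> _; exists g => //; rewrite flag_act_baseE.
Qed.

Lemma flag_transitive x : M x -> exists2 g, SO R (n * 2) g & x = flag_act g base.
Proof.
move=> Mx; have [dimx _ _ mn] := Mx.
have iso := flag_isotropic_sub Mx.
have [||j|h|g gSO gE] := @SO_conj R n r ns (fun j => cx_of (x j)) hm.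
- exact: flag_partial_cx.
- exact: flag_cx_mul0.
- by rewrite tr_cx_of // dimx.
- have [g gSO xE] := mn h; exists g => //.
  rewrite mulmx_sumr mulmx_suml; apply: eq_bigr => j _; rewrite xE /flag_act.
  rewrite cx_of_image ?(proj1 gSO) // cx_of_pos_plane //.
  exact: block_J_partial_cx.
exists g => //; rewrite flag_act_baseE ?(proj1 gSO) //; apply/funext => j.
by rewrite -gE pos_plane_cx_of.
Qed.

Lemma flag_map_inj x y : M x -> M y -> flag_map x = flag_map y -> x = y.
Proof.
move=> Mx My xy.
have h : (fun j => cx_of (x j)) = (fun j => cx_of (y j)).
  apply: component_inj => l.
  exact: (congr1 (fun F => F (widen_ord (leqnSn r) l)) xy).
apply/funext => j; have /= hj := congr1 (fun F => F j) h.
rewrite -(pos_plane_cx_of (flag_isotropic_sub Mx (j := j))) hj.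
exact/pos_plane_cx_of/flag_isotropic_sub.
Qed.

Lemma flag_map_orbit x : M x -> orbit_product R n ns (flag_map x).
Proof.
move=> /flag_transitive[g gSO ->] l; exists g => //.
by rewrite flag_map_act_base ?(proj1 gSO).
Qed.

Lemma flag_map_plane x (l : 'I_r.+1) : M x ->
  pos_plane (flag_map x l) = embedding_plane x l.
Proof.
move=> Mx; rewrite /flag_map pos_plane_component.
- rewrite /embedding_plane; congr (_ + _)%VS; apply: eq_bigr => j _;
    by rewrite pos_plane_cx_of //; exact: flag_isotropic_sub.
- exact: flag_partial_cx.
- exact: flag_cx_mul0.
Qed.

Lemma flag_map_smooth : flag_smooth ns (@flag_map R n r).
Proof.
move=> l g0 _; exists setT, (fun g => g *m Lambda R n ns l *m g^T); split => //.
- exact: openT.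
- by move=> k; exact: Ck_on_conjugation.
- by move=> g [gg _] _; rewrite flag_map_act_base.
Qed.

Lemma pushforward_flag_map x c X v l :
  SO_curve c X -> is_pushforward (@flag_map R n r) x c v ->
  v l = lie_bracket X (flag_map x l).
Proof.
move=> cX /(_ l) dF; have [cSO _ _] := cX.
have := is_derive_conjugation (flag_map x l) cX.
have -> : (fun t => c t *m flag_map x l *m (c t)^T) =
    (fun t => flag_map (flag_act (c t) x) l).
  by apply/funext => t; rewrite flag_map_act // (proj1 (cSO t)).
move=> dF'; rewrite -(@derive_val _ _ _ _ _ _ _ dF) (@derive_val _ _ _ _ _ _ _ dF').
by rewrite (SO_curve_so cX) mulmxN.
Qed.

(** A vanishing derivative means that [X] commutes with every component, hence
    with every [cx_of (x j)], hence that it preserves their eigenspaces. *)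
Lemma flag_map_immersion : flag_immersion ns (@flag_map R n r).
Proof.
move=> x Mx c X cX dF0 j.
have comm : X *m cx_of (x j) = cx_of (x j) *m X.
  apply/eqP; rewrite -subr_eq0; apply/eqP; move: j.
  apply: component_eq0 => l.
  rewrite (componentB (fun j => X *m cx_of (x j))).
  have -> : (fun j => X *m cx_of (x j)) = (fun j => X *m cx_of (x j) *m 1%:M).
    by apply/funext => j; rewrite mulmx1.
  have -> : (fun j => cx_of (x j) *m X) = (fun j => 1%:M *m cx_of (x j) *m X).
    by apply/funext => j; rewrite mul1mx.
  rewrite !(component_mulmx _ _ (fun j => cx_of (x j))) mulmx1 mul1mx.
  exact: esym (pushforward_flag_map (widen_ord (leqnSn r) l) cX dF0).
have iso := flag_isotropic_sub Mx (j := j); have Kcx := flag_partial_cx Mx j.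
apply: sub_vspace_cV => v /memv_imgP[u ux ->].
have vE : linfun (mulmx (cplx_mx X)) u = cplx_mx X *m u by rewrite lfunE.
rewrite vE.
have /eqP Hu : 'i%C *: cplx_mx (cx_of (x j)) *m u == u.
  by rewrite -(mem_pos_plane1 _ Kcx) pos_plane_cx_of.
rewrite -(pos_plane_cx_of iso) (mem_pos_plane1 _ Kcx) mulmxA -scalemxAl -cplxM.
by rewrite -comm cplxM scalemxAr -mulmxA Hu.
Qed.

Lemma sum_flag_map x : \sum_(l < r.+1) flag_map x l = 0.
Proof. exact: sum_component. Qed.

(** By invariance of the trace form, the value of the form at [l] only depends
    on the vectors generated at the [l]-th component, where [X l] and [Y l]
    can be replaced by [X0] and [Y0]. The sum over [l] is then the pairing of
    [[X0, Y0]] with the moment map, which vanishes on the image. *)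
Lemma flag_map_isotropic : flag_isotropic ns (@flag_map R n r).
Proof.
move=> x Mx c d X0 Y0 cX dY X Y _ _ hX hY.
have XE l := pushforward_flag_map l cX hX.
have YE l := pushforward_flag_map l dY hY.
rewrite /product_form.
transitivity (\sum_(l < r.+1) \tr (X0 *m lie_bracket Y0 (flag_map x l))).
  apply: eq_bigr => l _; rewrite /KKS -YE.
  have /= := XE l; rewrite /lie_bracket => XA.
  transitivity (- \tr ((X l *m flag_map x l - flag_map x l *m X l) *m Y l)).
    rewrite mulmxBl mulmxBr !mxtraceD !mxtraceN opprB; congr (_ - _).
      by rewrite !mulmxA.
    by rewrite mulmxA [LHS]mxtrace_mulC mulmxA.
  rewrite XA mulmxBl mulmxBr !mxtraceD !mxtraceN opprB; congr (_ - _).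
    by rewrite -mulmxA mxtrace_mulC !mulmxA.
  by rewrite mulmxA.
have -> : \sum_(l < r.+1) \tr (X0 *m lie_bracket Y0 (flag_map x l)) =
    \tr (X0 *m lie_bracket Y0 (\sum_(l < r.+1) flag_map x l)).
  rewrite /lie_bracket mulmx_sumr mulmx_suml -sumrB mulmx_sumr.
  by rewrite (raddf_sum (@mxtrace _ _)).
by rewrite sum_flag_map /lie_bracket mulmx0 mul0mx subrr mulmx0 mxtrace0.
Qed.

(** An open [U] corresponds to an open [V] of the group, and the orbit map
    sends the compact complement of [V] in SO(2n) onto a closed set, whose
    complement cuts out [U] because the map is injective. *)
Lemma flag_map_inducing : flag_inducing ns (@flag_map R n r).
Proof.
move=> U UM; split=> [[V oV UV]|[W oW ->]].
  pose phi g (l : 'I_r.+1) := g *m Lambda R n ns l *m g^T.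
  exists (~` (phi @` (SO R (n * 2) `&` ~` V))).
    by rewrite openC; exact: closed_orbit_image.
  apply/seteqP; split=> [x Ux|x [Mx]].
    split; first exact: UM.
    move=> [g [gSO nVg]] phiE; apply: nVg; apply/UV => //.
    suff -> : flag_act g base = x by [].
    apply: flag_map_inj; [exact: flag_act_base_mem|exact: UM|].
    by rewrite -phiE; apply/funext => l; rewrite flag_map_act_base ?(proj1 gSO).
  have [g gSO ->] := flag_transitive Mx => nphi; apply/UV => //.
  apply: contrapT => nVg; apply: nphi; exists g => //.
  by apply/funext => l; rewrite flag_map_act_base ?(proj1 gSO).
exists ((fun g (l : 'I_r.+1) => g *m Lambda R n ns l *m g^T) @^-1` W).
  by apply: open_comp oW => g _; exact: continuous_orbit_map.
move=> g gSO.
have FE : flag_map (flag_act g base) = (fun l => g *m Lambda R n ns l *m g^T).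
  by apply/funext => l; rewrite flag_map_act_base ?(proj1 gSO).
split=> [[_]|Wg]; first by rewrite /preimage /= FE.
by split; [exact: flag_act_base_mem|rewrite /preimage /= FE].
Qed.

(** [chain_decomposition] recovers structures [K j] from a point of the zero
    level, and [SO_conj] brings them to the blocks of the base flag; when
    [m = n], the last component, which is [- \sum_j K j], provides the required
    element of SO(2n). *)
Lemma flag_map_image :
  @flag_map R n r @` M = orbit_product R n ns `&` [set a | moment_map a = 0].
Proof.
apply/seteqP; split=> [_ [x Mx <-]|a [aO]].
  split; first exact: flag_map_orbit.
  by rewrite /= /moment_map sum_flag_map cplx0 scaler0.
rewrite /= /moment_map => ma.
have suma : \sum_(l < r.+1) a l = 0.
  by apply: scale_i_inj; rewrite ma cplx0 scaler0.
pose a' k := a (inord k).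
have a'E k : (k <= r)%N -> exists2 h, SO R (n * 2) h &
    a' k = h *m Lambda R n ns k *m h^T.
  by move=> kr; have [h hSO hE] := aO (inord k); exists h; rewrite // /a' hE inordK.
have Ecx := block_J_partial_cx (R := R) (n := n) ns.
have EE := @block_J_mul R n r ns.
have [|||K [Kcx KK trK aK]] :=
  @chain_decomposition R (n * 2) r a' (fun j => - (2 * (ns j)%:R)).
- move=> k kr; have [h [hh _] ->] := a'E k kr.
  have [scx ss] := signed_family k Ecx EE.
  rewrite LambdaE // componentE -scalemxAr -scalemxAl.
  have Qcx := partial_cx_conj hh (partial_cx_sum scx ss).
  by split; [rewrite trmxZ (proj1 Qcx) scalerN|exact: partial_cx_cube].
- by rewrite -[RHS]suma; apply: eq_bigr => k _; rewrite /a' inord_val.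
- move=> k; have kr := ltnW (ltn_ord k).
  have [h [hh _] ->] := a'E k kr.
  rewrite -!mulmxA (mulmxA h^T h) hh mul1mx mxtrace_mulC -!mulmxA hh mulmx1.
  rewrite LambdaE // tr_component_sqr //; congr (_ * _); apply: eq_bigr => j _.
  exact: tr_block_J_sqr.
have aE (l : 'I_r.+1) : a l = component K l.
  by rewrite -aK ?leq_ord // /a' inord_val.
have [|g gSO gE] := SO_conj hm Kcx KK trK.
  move=> mn; have [h hSO hE] := a'E r (leqnn r); exists h => //.
  have component_r (L : 'I_r -> 'M[R]_(n * 2)) : component L r = - \sum_j L j.
    rewrite /component /wt ltnn scale1r big_pred0 => [|j]; last by rewrite ltn_eqF.
    by rewrite sub0r; congr (- _); apply: eq_bigl => j; rewrite ltn_ord.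
  move: hE; rewrite aK // LambdaE // !component_r mulmxN mulNmx.
  exact: oppr_inj.
exists (flag_act g base); first exact: flag_act_base_mem.
apply/funext => l; rewrite flag_map_act_base ?(proj1 gSO) // aE LambdaE ?leq_ord //.
by rewrite -component_mulmx; congr (component _ l); apply/funext => j; rewrite gE.
Qed.

End flag_map_facts.

Theorem proposition5 (R : realType) (n r : nat) (ns : 'I_r -> nat)
    (hn : (1 <= n)%N) (hr : (1 <= r)%N)
    (hns : forall j : 'I_r, (0 < ns j)%N)
    (hm : (\sum_(j < r) ns j <= n)%N) :
  exists F : flag R n r -> 'I_r.+1 -> 'M[R]_(n * 2),
    [/\ forall x, flag_manifold R n ns x ->
          orbit_product R n ns (F x) /\
          forall l : 'I_r.+1, pos_plane (F x l) = embedding_plane x l,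
        flag_embedding ns F,
        flag_isotropic ns F
      & F @` flag_manifold R n ns =
        orbit_product R n ns `&` [set a | moment_map a = 0]].
Proof.
exists (@flag_map R n r); split.
- move=> x Mx; split; first exact: flag_map_orbit.
  by move=> l; exact: (flag_map_plane l Mx).
- split; [exact: flag_map_inj|exact: flag_map_smooth|exact: flag_map_immersion|].
  exact: flag_map_inducing.
- exact: flag_map_isotropic.
- exact: flag_map_image.
Qed.
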